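(* Let $\lambda\ge 1$ and let $f:\mathbb{D}\to\mathbb{D}$ be holomorphic. In case $\lambda=1$, suppose also that $f(0)\neq 0$ and that $f\notin\mathrm{Aut}(\mathbb{D})$. Then the set $$\Omega_\lambda(f):=\Big\{z\in\mathbb{D}\colon \frac{1-|f(z)|^2}{1-|z|^2}<\lambda\Big\}$$ is a strictly hyperbolically convex domain containing the origin.
   Context: $\mathbb{D}=\{z\in\mathbb{C}:|z|<1\}$ is the open unit disk, and $\mathrm{Aut}(\mathbb{D})$ is the set of its conformal automorphisms. $\mathbb{D}$ is equipped with the Poincaré distance $$k_{\mathbb{D}}(z,w)=\log\frac{1+\rho(z,w)}{1-\rho(z,w)},\qquad \rho(z,w)=\left|\frac{z-w}{1-\overline{w}z}\right|.$$ Hyperbolic geodesics are the diameters of $\mathbb{D}$ and the arcs in $\mathbb{D}$ of circles orthogonal to $\partial\mathbb{D}$. For $z_1,z_2\in\mathbb{D}$, $[z_1,z_2]_h$ denotes the unique hyperbolic geodesic segment joining $z_1$ and $z_2$. A set $\Omega\subset\mathbb{D}$ is hyperbolically convex (h-convex) if $[z_1,z_2]_h\subset\Omega$ whenever $z_1,z_2\in\Omega$. It is strictly hyperbolically convex if, in addition, every hyperbolic geodesic intersects $\partial\Omega$ at two points at most. A domain is a nonempty connected open set. *)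

(* Defs.v *)
From Stdlib Require Import Reals.
From Coquelicot Require Import Coquelicot.
Open Scope R_scope.

(* Topology of the plane.  Note that Coquelicot's [ball] on [C] is an open
   square; it induces the usual topology. *)

Definition connected (A : C -> Prop) : Prop :=
  forall U V : C -> Prop, open U -> open V ->
    (forall z, A z -> U z \/ V z) ->
    (forall z, ~ (A z /\ U z /\ V z)) ->
    ~ ((exists z, A z /\ U z) /\ (exists z, A z /\ V z)).

Definition is_domain (A : C -> Prop) : Prop :=
  (exists z, A z) /\ open A /\ connected A.

Definition boundary (A : C -> Prop) (z : C) : Prop :=
  forall eps : posreal,
    (exists w, ball z eps w /\ A w) /\ (exists w, ball z eps w /\ ~ A w).

Definition disk (z : C) : Prop := Cmod z < 1.

(* A function on the disk is represented by a total function on [C] whose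
   values off the disk are irrelevant; as the disk is open, differentiability
   at its points only depends on the restriction. *)

Definition holomorphic_on_disk (f : C -> C) : Prop :=
  forall z, disk z -> @ex_derive C_AbsRing C_NormedModule f z.

Definition holomorphic_self_map (f : C -> C) : Prop :=
  (forall z, disk z -> disk (f z)) /\ holomorphic_on_disk f.

Definition disk_automorphism (f : C -> C) : Prop :=
  holomorphic_self_map f /\
  exists g : C -> C, holomorphic_self_map g /\
    (forall z, disk z -> g (f z) = z) /\ (forall z, disk z -> f (g z) = z).

Definition rho (z w : C) : R :=
  Cmod ((z - w) / (RtoC 1 - Cconj w * z))%C.

Definition poincare_dist (z w : C) : R :=
  ln ((1 + rho z w) / (1 - rho z w)).

Definition circle (c : C) (r : R) (z : C) : Prop := Cmod (z - c)%C = r.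

(* Two circles are orthogonal if they meet and, at each common point, their
   radii (hence their tangent lines) are perpendicular; [Re (a * conj b)] is
   the Euclidean inner product of [a] and [b]. *)
Definition orthogonal_circles (c1 : C) (r1 : R) (c2 : C) (r2 : R) : Prop :=
  (exists p, circle c1 r1 p /\ circle c2 r2 p) /\
  forall p, circle c1 r1 p -> circle c2 r2 p ->
    Re ((p - c1) * Cconj (p - c2))%C = 0.

Definition is_diameter (G : C -> Prop) : Prop :=
  exists u : C, Cmod u = 1 /\
    forall z, G z <-> disk z /\ exists t : R, z = (RtoC t * u)%C.

Definition is_orthogonal_arc (G : C -> Prop) : Prop :=
  exists (c : C) (r : R), 0 < r /\ orthogonal_circles c r (RtoC 0) 1 /\
    forall z, G z <-> disk z /\ circle c r z.

Definition hyperbolic_geodesic (G : C -> Prop) : Prop :=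
  is_diameter G \/ is_orthogonal_arc G.

(* The points of a geodesic through [z1] and [z2] that lie between them, in
   the sense that the Poincare distance adds up along the geodesic. *)
Definition hyperbolic_segment (z1 z2 z : C) : Prop :=
  exists G : C -> Prop, hyperbolic_geodesic G /\ G z1 /\ G z2 /\ G z /\
    poincare_dist z1 z + poincare_dist z z2 = poincare_dist z1 z2.

Definition h_convex (A : C -> Prop) : Prop :=
  (forall z, A z -> disk z) /\
  forall z1 z2, A z1 -> A z2 -> forall z, hyperbolic_segment z1 z2 z -> A z.

Definition strictly_h_convex (A : C -> Prop) : Prop :=
  h_convex A /\
  forall G : C -> Prop, hyperbolic_geodesic G ->
    forall p q r, G p -> G q -> G r ->
      boundary A p -> boundary A q -> boundary A r ->
      p = q \/ p = r \/ q = r.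

Definition Omega (lambda : R) (f : C -> C) (z : C) : Prop :=
  disk z /\ (1 - Cmod (f z) ^ 2) / (1 - Cmod z ^ 2) < lambda.

(* Main.v *)
Require Import Defs.
From Stdlib Require Import Reals Lra Psatz ClassicalEpsilon List.
From Coquelicot Require Import Coquelicot.
Open Scope R_scope.

(** Let [u z = (1 - |f z|^2) / (1 - |z|^2)], so that the set under study is
    [u < lambda] in the disk. The heart of the matter is that along a hyperbolic
    geodesic [u] has no local maximum of value at least 1, except at level 1 when [f]
    is an automorphism ([density_exceeded_on_geodesic]). Hence, on a geodesic arc
    whose endpoints satisfy [u <= lambda], one has [u < lambda] strictly in between
    ([density_lt_between]). This gives hyperbolic convexity, and also strictness:
    [u = lambda] at the boundary points inside the disk, so of three such points on
    one geodesic the middle one would satisfy [u < lambda]. It gives connectedness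
    as well, the radii being geodesic segments issued from the origin.

    Why there is no such maximum: let [p] be a point, [b = f p], and move [p] and [b]
    to the origin by automorphisms of the disk, so that [f] becomes [w k(w)] with
    [|k| <= 1]. On the geodesic through [p] in the direction [eta], at the point of
    parameter [t], the quotient [u / u p] is
    [(1 - t^2 |k|^2) |1 + t (conj p) eta|^2 / ((1 - t^2) |1 + t (conj b) eta k|^2)].
    If it were at most 1 at [t] and at [- t] for all small [t], adding the two
    inequalities would cancel the odd terms, except for the difference of the two
    values of [k], which by the Schwarz-Pick lemma for [k] is at most
    [2 t (1 - |k 0|^2)] to leading order. Dividing by [2 t^2] and letting [t] tend to 0
    leaves [(1 - |k 0|^2) (1 - |b|)^2 + |p|^2 - |b|^2 <= 0]. But [u p >= 1] means
    [|b| <= |p|], so both terms vanish: [u p = 1] and [|k 0| = 1], and the latter makes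
    [f] an automorphism by the equality case of Schwarz-Pick. Using the two points
    [t] and [- t] instead of a second derivative, the argument asks of [k] only
    continuity at the base point.

    The function theory needed is thus the Schwarz-Pick lemma for difference quotients
    such as [k] ([schwarz_pick]). It follows from a maximum principle for functions
    that are continuous in the disk and complex differentiable off a finite set
    ([maximum_principle]), which rests on the mean value property on small circles
    ([circle_mean_value]); and that is Goursat's quadrisection argument
    ([circulation_closed_form]) in logarithmic polar coordinates. *)

(** * Quadrisection and circulations of closed forms *)

Definition box : Type := (R * R * (R * R))%type.

(** The box [a <= x <= b], [c <= y <= d] is coded as [(a, b, (c, d))]; the result is
    only meaningful when [P] fails on some quarter. *)
Definition failing_quarter (P : R -> R -> R -> R -> Prop) (q : box) : box :=
  let '(a, b, (c, d)) := q in
  let m := (a + b) / 2 in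
  let n := (c + d) / 2 in
  if excluded_middle_informative (~ P a m c n) then (a, m, (c, n))
  else if excluded_middle_informative (~ P m b c n) then (m, b, (c, n))
  else if excluded_middle_informative (~ P a m n d) then (a, m, (n, d))
  else (m, b, (n, d)).

(** Quadrisection: were [P] false on the whole box it would fail on a nested
    sequence of quarters shrinking to a point, contradicting the local
    hypothesis there. This single compactness principle yields the vanishing of
    circulations, the maximum of a function on a disk, and connectedness. *)
Lemma box_induction (P : R -> R -> R -> R -> Prop) (a0 b0 c0 d0 : R)
  (hab : a0 <= b0) (hcd : c0 <= d0)
  (hsplit : forall a b c d, a0 <= a -> a <= b -> b <= b0 ->
     c0 <= c -> c <= d -> d <= d0 ->
     P a ((a + b) / 2) c ((c + d) / 2) -> P ((a + b) / 2) b c ((c + d) / 2) ->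
     P a ((a + b) / 2) ((c + d) / 2) d -> P ((a + b) / 2) b ((c + d) / 2) d ->
     P a b c d)
  (hlocal : forall x y, a0 <= x <= b0 -> c0 <= y <= d0 ->
     exists delta, 0 < delta /\ forall a b c d,
       a0 <= a -> a <= x -> x <= b -> b <= b0 ->
       c0 <= c -> c <= y -> y <= d -> d <= d0 ->
       b - a < delta -> d - c < delta -> P a b c d) :
  P a0 b0 c0 d0.
Proof.
destruct (excluded_middle_informative (P a0 b0 c0 d0)) as [h | h0]; [exact h | exfalso].
set (s := fun n => Nat.iter n (failing_quarter P) (a0, b0, (c0, d0))).
set (a := fun n => fst (fst (s n))).
set (b := fun n => snd (fst (s n))).
set (c := fun n => fst (snd (s n))).
set (d := fun n => snd (snd (s n))).
assert (hinv : forall n, a0 <= a n /\ a n <= b n /\ b n <= b0 /\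
  c0 <= c n /\ c n <= d n /\ d n <= d0 /\ ~ P (a n) (b n) (c n) (d n) /\
  a n <= a (S n) /\ b (S n) <= b n /\ c n <= c (S n) /\ d (S n) <= d n /\
  b (S n) - a (S n) = (b n - a n) / 2 /\ d (S n) - c (S n) = (d n - c n) / 2).
{ assert (hstep : forall n, a0 <= a n -> a n <= b n -> b n <= b0 ->
    c0 <= c n -> c n <= d n -> d n <= d0 -> ~ P (a n) (b n) (c n) (d n) ->
    ~ P (a (S n)) (b (S n)) (c (S n)) (d (S n)) /\
    a n <= a (S n) /\ b (S n) <= b n /\ c n <= c (S n) /\ d (S n) <= d n /\
    b (S n) - a (S n) = (b n - a n) / 2 /\ d (S n) - c (S n) = (d n - c n) / 2).
  { intros n; unfold a, b, c, d; change (s (S n)) with (failing_quarter P (s n)).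
    destruct (s n) as [[x x'] [y y']]; simpl; intros.
    destruct (excluded_middle_informative (~ P x ((x + x') / 2) y ((y + y') / 2)));
      simpl; [repeat split; auto; lra |].
    destruct (excluded_middle_informative (~ P ((x + x') / 2) x' y ((y + y') / 2)));
      simpl; [repeat split; auto; lra |].
    destruct (excluded_middle_informative (~ P x ((x + x') / 2) ((y + y') / 2) y'));
      simpl; [repeat split; auto; lra |].
    repeat split; try lra.
    intros hP; apply H5; apply hsplit; auto; apply NNPP; auto. }
  intros n.
  assert (hn : a0 <= a n /\ a n <= b n /\ b n <= b0 /\
    c0 <= c n /\ c n <= d n /\ d n <= d0 /\ ~ P (a n) (b n) (c n) (d n)).
  { induction n as [|n IH]; [unfold a, b, c, d; simpl; repeat split; auto; lra |].
    destruct IH as (h1 & h2 & h3 & h4 & h5 & h6 & h7).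
    destruct (hstep n h1 h2 h3 h4 h5 h6 h7) as (k1 & k2 & k3 & k4 & k5 & k6 & k7).
    repeat split; auto; lra. }
  destruct hn as (h1 & h2 & h3 & h4 & h5 & h6 & h7).
  destruct (hstep n h1 h2 h3 h4 h5 h6 h7) as (k1 & k2 & k3 & k4 & k5 & k6 & k7).
  repeat split; auto; lra. }
assert (nested : forall (u v : nat -> R),
  (forall n, u n <= v n /\ u n <= u (S n) /\ v (S n) <= v n) ->
  exists x, forall n, u n <= x <= v n).
{ intros u v h.
  assert (hu : forall n m, u n <= u (n + m)%nat).
  { intros n m; induction m as [|m IH]; [rewrite Nat.add_0_r; lra |].
    rewrite Nat.add_succ_r; destruct (h (n + m)%nat); lra. }
  assert (hv : forall n m, v (n + m)%nat <= v n).
  { intros n m; induction m as [|m IH]; [rewrite Nat.add_0_r; lra |].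
    rewrite Nat.add_succ_r; destruct (h (n + m)%nat); lra. }
  assert (huv : forall n m, u n <= v m).
  { intros n m; generalize (hu n m) (hv m n) (h (n + m)%nat).
    rewrite (Nat.add_comm m n); lra. }
  destruct (completeness (fun x => exists n, x = u n)) as [x [hx1 hx2]].
  - exists (v O); intros x [n ->]; apply huv.
  - exists (u O), O; reflexivity.
  - exists x; intros n; split; [apply hx1; exists n; reflexivity |].
    apply hx2; intros y [m ->]; apply huv. }
destruct (nested a b) as [x hx]; [intros n; destruct (hinv n); tauto |].
destruct (nested c d) as [y hy]; [intros n; destruct (hinv n); tauto |].
assert (hx0 : a0 <= x <= b0) by exact (hx O).
assert (hy0 : c0 <= y <= d0) by exact (hy O).
destruct (hlocal x y hx0 hy0) as [delta [hdelta hP]].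
assert (hw : forall n, b n - a n = (b0 - a0) * (/ 2) ^ n /\
                       d n - c n = (d0 - c0) * (/ 2) ^ n).
{ induction n as [|n [IH1 IH2]]; [unfold a, b, c, d; simpl; split; ring |].
  destruct (hinv n) as (_ & _ & _ & _ & _ & _ & _ & _ & _ & _ & _ & k1 & k2).
  rewrite k1, k2, IH1, IH2; simpl; split; field. }
assert (hlen : 0 < (b0 - a0) + (d0 - c0) + 1) by lra.
(* [N] halvings bring both sides of the box below [delta] *)
destruct (pow_lt_1_zero (/ 2) ltac:(rewrite Rabs_pos_eq; lra)
  (delta / ((b0 - a0) + (d0 - c0) + 1))) as [N hN].
{ apply Rdiv_lt_0_compat; lra. }
specialize (hN N (Nat.le_refl N)).
assert (hpow : 0 < (/ 2) ^ N) by (apply pow_lt; lra).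
rewrite Rabs_pos_eq in hN by lra.
apply (Rmult_lt_compat_r _ _ _ hlen) in hN.
replace (delta / (b0 - a0 + (d0 - c0) + 1) * (b0 - a0 + (d0 - c0) + 1)) with delta
  in hN by (field; lra).
destruct (hinv N) as (h1 & h2 & h3 & h4 & h5 & h6 & h7 & _).
destruct (hw N) as [w1 w2], (hx N), (hy N).
apply h7, hP; auto; nra.
Qed.

Lemma RInt_near_constant (g : R -> R) (a b K M : R) :
  a <= b -> (forall x, a <= x <= b -> continuous g x) ->
  (forall x, a <= x <= b -> Rabs (g x - K) <= M) ->
  Rabs (RInt g a b - K * (b - a)) <= M * (b - a).
Proof.
intros hab hc hM.
assert (hi : ex_RInt g a b).
{ apply (ex_RInt_continuous (V := R_CompleteNormedModule)); intros x hx.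
  rewrite Rmin_left, Rmax_right in hx by lra; apply hc; lra. }
assert (hconst : forall k, RInt (fun _ => k) a b = k * (b - a)).
{ intros k; rewrite RInt_const; unfold scal; simpl; unfold mult; simpl; ring. }
assert (h1 : RInt g a b <= (K + M) * (b - a)).
{ rewrite <- hconst; apply RInt_le; auto; [apply ex_RInt_const |].
  intros x hx; assert (h := hM x ltac:(lra)); apply Rabs_le_between in h; lra. }
assert (h2 : (K - M) * (b - a) <= RInt g a b).
{ rewrite <- hconst; apply RInt_le; auto; [apply ex_RInt_const |].
  intros x hx; assert (h := hM x ltac:(lra)); apply Rabs_le_between in h; lra. }
apply Rabs_le_between; nra.
Qed.

Definition circulation (A B : R -> R -> R) (a b c d : R) : R :=
  RInt (fun x => A x c) a b - RInt (fun x => A x d) a b +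
  RInt (fun y => B b y) c d - RInt (fun y => B a y) c d.

(** The shared coefficient [l] says that the form [A dx + B dy] is closed at
    [(x, y)]. *)
Definition closed_form_at (A B : R -> R -> R) (x y : R) : Prop :=
  exists p l q, differentiable_pt_lim A x y p l /\ differentiable_pt_lim B x y l q.

Lemma differentiable_continuous_l (A : R -> R -> R) (x y p q : R) :
  differentiable_pt_lim A x y p q -> continuous (fun t => A t y) x.
Proof.
intros h; apply continuity_pt_filterlim, derivable_continuous_pt.
exists (p * 1 + q * 0).
exact (derivable_pt_lim_comp_2d A (fun t => t) (fun _ => y) x p q 1 0 h
  (derivable_pt_lim_id x) (derivable_pt_lim_const y x)).
Qed.

Lemma differentiable_continuous_r (A : R -> R -> R) (x y p q : R) :
  differentiable_pt_lim A x y p q -> continuous (fun t => A x t) y.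
Proof.
intros h; apply continuity_pt_filterlim, derivable_continuous_pt.
exists (p * 0 + q * 1).
exact (derivable_pt_lim_comp_2d A (fun _ => x) (fun t => t) y p q 0 1 h
  (derivable_pt_lim_const x y) (derivable_pt_lim_id y)).
Qed.

(** Goursat's argument. The form [A dx + B dy] is only assumed differentiable at
    each point, with [dA/dy = dB/dx], so Green's formula is unavailable.
    Instead, the circulation is additive under quadrisection, and around a small
    box it is an error of second order, because an affine closed form has
    circulation zero. Comparing with [width^2 + height^2], which quadrisection
    splits exactly into four, avoids any control of the shape of the boxes. *)
Lemma circulation_closed_form (A B : R -> R -> R) (a0 b0 c0 d0 : R) :
  a0 <= b0 -> c0 <= d0 ->
  (forall x y, a0 <= x <= b0 -> c0 <= y <= d0 -> closed_form_at A B x y) ->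
  circulation A B a0 b0 c0 d0 = 0.
Proof.
intros hab hcd hAB.
assert (hA1 : forall x y, a0 <= x <= b0 -> c0 <= y <= d0 -> continuous (fun t => A t y) x).
{ intros x y hx hy; destruct (hAB x y hx hy) as (p & l & q & h & _).
  exact (differentiable_continuous_l A x y p l h). }
assert (hB2 : forall x y, a0 <= x <= b0 -> c0 <= y <= d0 -> continuous (fun t => B x t) y).
{ intros x y hx hy; destruct (hAB x y hx hy) as (p & l & q & _ & h).
  exact (differentiable_continuous_r B x y l q h). }
assert (hAi : forall y a b, c0 <= y <= d0 -> a0 <= a -> a <= b -> b <= b0 ->
  ex_RInt (fun x => A x y) a b).
{ intros y a b hy h1 h2 h3.
  apply (ex_RInt_continuous (V := R_CompleteNormedModule) (fun x => A x y)).
  intros x hx.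
  rewrite Rmin_left, Rmax_right in hx by lra; apply hA1; lra. }
assert (hBi : forall x c d, a0 <= x <= b0 -> c0 <= c -> c <= d -> d <= d0 ->
  ex_RInt (fun y => B x y) c d).
{ intros x c d hx h1 h2 h3.
  apply (ex_RInt_continuous (V := R_CompleteNormedModule) (fun y => B x y)).
  intros y hy.
  rewrite Rmin_left, Rmax_right in hy by lra; apply hB2; lra. }
assert (main : forall eps, 0 < eps ->
  Rabs (circulation A B a0 b0 c0 d0) <= eps * ((b0 - a0) ^ 2 + (d0 - c0) ^ 2)).
{ intros eps heps.
  apply (box_induction (fun a b c d =>
    Rabs (circulation A B a b c d) <= eps * ((b - a) ^ 2 + (d - c) ^ 2))); auto.
  - intros a b c d ha hab' hb hc hcd' hd.
    set (m := (a + b) / 2); set (n := (c + d) / 2); intros h1 h2 h3 h4.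
    assert (hm : a <= m <= b) by (unfold m; lra).
    assert (hn : c <= n <= d) by (unfold n; lra).
    assert (hsum : circulation A B a b c d =
      circulation A B a m c n + circulation A B m b c n +
      (circulation A B a m n d + circulation A B m b n d)).
    { unfold circulation.
      rewrite <- (RInt_Chasles (fun x => A x c) a m b) by (apply hAi; lra).
      rewrite <- (RInt_Chasles (fun x => A x d) a m b) by (apply hAi; lra).
      rewrite <- (RInt_Chasles (fun y => B a y) c n d) by (apply hBi; lra).
      rewrite <- (RInt_Chasles (fun y => B b y) c n d) by (apply hBi; lra).
      unfold plus; simpl; ring. }
    rewrite hsum.
    replace (eps * ((b - a) ^ 2 + (d - c) ^ 2)) with
      (eps * ((m - a) ^ 2 + (n - c) ^ 2) + eps * ((b - m) ^ 2 + (n - c) ^ 2) +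
       (eps * ((m - a) ^ 2 + (d - n) ^ 2) + eps * ((b - m) ^ 2 + (d - n) ^ 2)))
      by (unfold m, n; field).
    repeat (eapply Rle_trans; [apply Rabs_triang |]; apply Rplus_le_compat); auto.
  - intros x y hx hy; destruct (hAB x y hx hy) as (p & l & q & h1 & h2).
    assert (he : 0 < eps / 4) by lra.
    destruct (h1 (mkposreal _ he)) as [d1 hd1], (h2 (mkposreal _ he)) as [d2 hd2].
    exists (Rmin d1 d2); split; [apply Rmin_case; apply cond_pos |].
    intros a b c d ha hax hxb hb hc hcy hyd hd hba hdc.
    assert (hd1' := Rmin_l d1 d2); assert (hd2' := Rmin_r d1 d2).
    assert (hmax : forall u v, a <= u <= b -> c <= v <= d ->
      0 <= Rmax (Rabs (u - x)) (Rabs (v - y)) <= (b - a) + (d - c)).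
    { intros u v hu hv; split.
      - apply Rle_trans with (Rabs (u - x)); [apply Rabs_pos | apply Rmax_l].
      - apply Rmax_lub; apply Rabs_le_between; lra. }
    assert (eA : forall u v, a <= u <= b -> c <= v <= d ->
      Rabs (A u v - A x y - (p * (u - x) + l * (v - y))) <= eps / 4 * ((b - a) + (d - c))).
    { intros u v hu hv; eapply Rle_trans; [apply (hd1 u v) |].
      - apply Rabs_def1; lra.
      - apply Rabs_def1; lra.
      - apply Rmult_le_compat_l; [simpl; lra | apply hmax; auto]. }
    assert (eB : forall u v, a <= u <= b -> c <= v <= d ->
      Rabs (B u v - B x y - (l * (u - x) + q * (v - y))) <= eps / 4 * ((b - a) + (d - c))).
    { intros u v hu hv; eapply Rle_trans; [apply (hd2 u v) |].
      - apply Rabs_def1; lra.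
      - apply Rabs_def1; lra.
      - apply Rmult_le_compat_l; [simpl; lra | apply hmax; auto]. }
    assert (iA : Rabs (RInt (fun u => A u c - A u d) a b - l * (c - d) * (b - a)) <=
      eps / 2 * ((b - a) + (d - c)) * (b - a)).
    { apply RInt_near_constant; [lra | |].
      - intros u hu; apply (continuous_minus (fun u => A u c) (fun u => A u d));
          apply hA1; lra.
      - intros u hu; generalize (eA u c hu ltac:(lra)) (eA u d hu ltac:(lra)).
        intros k1 k2; apply Rabs_le_between in k1, k2; apply Rabs_le_between; lra. }
    assert (iB : Rabs (RInt (fun v => B b v - B a v) c d - l * (b - a) * (d - c)) <=
      eps / 2 * ((b - a) + (d - c)) * (d - c)).
    { apply RInt_near_constant; [lra | |].
      - intros v hv; apply (continuous_minus (fun v => B b v) (fun v => B a v));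
          apply hB2; lra.
      - intros v hv; generalize (eB b v ltac:(lra) hv) (eB a v ltac:(lra) hv).
        intros k1 k2; apply Rabs_le_between in k1, k2; apply Rabs_le_between; lra. }
    replace (circulation A B a b c d) with
      (RInt (fun u => A u c - A u d) a b + RInt (fun v => B b v - B a v) c d).
    2:{ unfold circulation.
        rewrite (RInt_minus (fun u => A u c) (fun u => A u d)) by (apply hAi; lra).
        rewrite (RInt_minus (fun v => B b v) (fun v => B a v)) by (apply hBi; lra).
        unfold minus, plus, opp; simpl; ring. }
    apply Rabs_le_between in iA, iB; apply Rabs_le_between.
    (* the product terms [l (b - a) (d - c)] of [iA] and [iB] cancel *)
    assert (hsq : eps * (((b - a) + (d - c)) ^ 2) <= eps * (2 * ((b - a) ^ 2 + (d - c) ^ 2))).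
    { apply Rmult_le_compat_l; [lra |].
      assert (0 <= ((b - a) - (d - c)) ^ 2) by apply pow2_ge_0; lra. }
    lra. }
destruct (Req_dec (circulation A B a0 b0 c0 d0) 0) as [h | h]; auto; exfalso.
apply Rabs_pos_lt in h.
set (L := (b0 - a0) ^ 2 + (d0 - c0) ^ 2) in *.
assert (hL : 0 <= L)
  by (unfold L; generalize (pow2_ge_0 (b0 - a0)) (pow2_ge_0 (d0 - c0)); lra).
specialize (main (Rabs (circulation A B a0 b0 c0 d0) / (L + 1))
  ltac:(apply Rdiv_lt_0_compat; lra)).
assert (h2 : Rabs (circulation A B a0 b0 c0 d0) / (L + 1) * L <
  Rabs (circulation A B a0 b0 c0 d0)).
{ replace (Rabs (circulation A B a0 b0 c0 d0)) with
    (Rabs (circulation A B a0 b0 c0 d0) / (L + 1) * (L + 1)) at 2 by (field; lra).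
  apply Rmult_lt_compat_l; [apply Rdiv_lt_0_compat; lra | lra]. }
lra.
Qed.

(** * Complex differentiability and mean values on circles *)

(** Complex derivatives at a point of the plane are taken with the plane normed by
    [Cmod] over itself; [C_metric] is its uniform structure, whose balls are the
    Euclidean disks, as opposed to the squares of [C_UniformSpace]. *)
Notation C_normed := (AbsRing_NormedModule C_AbsRing).
Notation C_metric := (AbsRing_UniformSpace C_AbsRing).
Notation Ccontinuous := (@continuous C_metric C_metric).
Notation Cdifferentiable := (@ex_derive C_AbsRing C_normed).

Lemma locally_metric (z : C) (P : C -> Prop) :
  @locally C_metric z P <-> exists d, 0 < d /\ forall w, Cmod (w - z) < d -> P w.
Proof.
split.
- intros [d hd]; exists d; split; [apply cond_pos |].
  intros w hw; apply hd; exact hw.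
- intros (d & h & hd); exists (mkposreal d h); intros w hw; apply hd; exact hw.
Qed.

Lemma Ccontinuous_eps (g : C -> C) (z : C) :
  Ccontinuous g z <-> forall eps, 0 < eps -> exists d, 0 < d /\
    forall w, Cmod (w - z) < d -> Cmod (g w - g z) < eps.
Proof.
split.
- intros h eps heps.
  apply (locally_metric z (fun w => Cmod (g w - g z) < eps)).
  apply (h (fun y : C => Cmod (y - g z) < eps)).
  apply (proj2 (locally_metric (g z) _)); exists eps; auto.
- intros h P hP; apply locally_metric in hP; destruct hP as (e & he & hP).
  destruct (h e he) as (d & hd & hw); apply (proj2 (locally_metric z _)).
  exists d; split; auto; intros w hw'; apply hP, hw, hw'.
Qed.

Lemma is_derive_C_eps (g : C -> C) (z l : C) :
  @is_derive C_AbsRing C_normed g z l <->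
  forall eps, 0 < eps -> exists d, 0 < d /\ forall w, Cmod (w - z) < d ->
    Cmod (g w - g z - l * (w - z))%C <= eps * Cmod (w - z).
Proof.
split.
- intros [_ h] eps heps.
  specialize (h z (fun P hP => hP) (mkposreal eps heps)); simpl in h.
  apply locally_metric in h; destruct h as (d & hd & h).
  exists d; split; auto; intros w hw; specialize (h w hw).
  replace (g w - g z - l * (w - z))%C with
    (minus (minus (g w) (g z)) (scal (minus w z) l) : C); [exact h |].
  unfold minus, plus, opp, scal, mult; simpl; unfold mult; simpl; ring.
- intros h; split; [apply is_linear_scal_l |].
  intros x hx; apply (@is_filter_lim_locally_unique C_AbsRing C_normed) in hx; subst x.
  intros [eps heps]; simpl.
  destruct (h eps heps) as (d & hd & hw).
  apply (proj2 (locally_metric z _)); exists d; split; auto.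
  intros w hw'; specialize (hw w hw').
  refine (Rle_trans _ _ _ (Req_le _ _ (f_equal Cmod _)) hw).
  unfold minus, plus, opp, scal, mult; simpl; unfold mult; simpl; ring.
Qed.

(** The Cauchy-Riemann equations. *)
Lemma is_derive_C_components (g : C -> C) (x y : R) (l : C) :
  @is_derive C_AbsRing C_normed g (x, y) l ->
  differentiable_pt_lim (fun u v => Re (g (u, v))) x y (Re l) (- Im l) /\
  differentiable_pt_lim (fun u v => Im (g (u, v))) x y (Im l) (Re l).
Proof.
intros h; rewrite is_derive_C_eps in h.
assert (h' : forall eps : posreal, locally_2d (fun u v =>
  Cmod (g (u, v) - g (x, y) - l * ((u, v) - (x, y)))%C <=
    eps * Rmax (Rabs (u - x)) (Rabs (v - y))) x y).
{ intros eps; assert (he := cond_pos eps).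
  destruct (h (eps / 2) ltac:(lra)) as (d & hd & hw).
  assert (hd2 : 0 < d / 2) by lra.
  exists (mkposreal _ hd2); simpl; intros u v hu hv.
  assert (hC : Cmod ((u, v) - (x, y))%C <= 2 * Rmax (Rabs (u - x)) (Rabs (v - y))).
  { eapply Rle_trans; [apply Cmod_2Rmax |].
    change (fst _) with (u - x); change (snd _) with (v - y).
    apply Rmult_le_compat_r.
    - apply Rle_trans with (Rabs (u - x)); [apply Rabs_pos | apply Rmax_l].
    - left; apply sqrt_less_alt; lra. }
  assert (hm : Rmax (Rabs (u - x)) (Rabs (v - y)) < d / 2) by (apply Rmax_case; auto).
  eapply Rle_trans; [apply hw; lra |].
  nra. }
split; intros eps; destruct (h' eps) as [d hd]; exists d; intros u v hu hv;
  (eapply Rle_trans; [| apply (hd u v hu hv)]).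
- replace (Re (g (u, v)) - Re (g (x, y)) - (Re l * (u - x) + - Im l * (v - y))) with
    (Re (g (u, v) - g (x, y) - l * ((u, v) - (x, y)))%C)
    by (destruct (g (u, v)), (g (x, y)), l; simpl; ring).
  apply re_le_Cmod.
- replace (Im (g (u, v)) - Im (g (x, y)) - (Im l * (u - x) + Re l * (v - y))) with
    (Im (g (u, v) - g (x, y) - l * ((u, v) - (x, y)))%C)
    by (destruct (g (u, v)), (g (x, y)), l; simpl; ring).
  eapply Rle_trans; [apply Rmax_r | apply Rmax_Cmod].
Qed.

(** The two coordinates of [x0 + exp (s + i t)] as functions of [(s, t)]: the
    logarithmic polar coordinates in which circles become vertical segments. *)
Lemma differentiable_exp_trig (x0 : R) (tr tr' : R -> R) (s t : R) :
  derivable_pt_lim tr t (tr' t) ->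
  differentiable_pt_lim (fun s t => x0 + exp s * tr t) s t
    (exp s * tr t) (exp s * tr' t).
Proof.
intros htr.
assert (hmul : forall a b, differentiable_pt_lim (fun u v => x0 + u * v) a b b a).
{ intros a b [eps heps]; exists (mkposreal eps heps); simpl; intros u v hu hv.
  replace (x0 + u * v - (x0 + a * b) - (b * (u - a) + a * (v - b))) with
    ((u - a) * (v - b)) by ring.
  rewrite Rabs_mult; apply Rmult_le_compat; try apply Rabs_pos; [lra | apply Rmax_r]. }
assert (h2 : differentiable_pt_lim (fun _ t => tr t) s t 0 (tr' t)).
{ intros [eps heps]; destruct (htr eps heps) as [d hd].
  exists d; intros u v hu hv; simpl.
  destruct (Req_dec v t) as [-> | hvt].
  - replace (tr t - tr t - _) with 0 by ring; rewrite Rabs_R0.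
    apply Rmult_le_pos; [lra |].
    apply Rle_trans with (Rabs (u - s)); [apply Rabs_pos | apply Rmax_l].
  - specialize (hd (v - t) ltac:(lra) hv).
    replace (t + (v - t)) with v in hd by ring.
    replace (tr v - tr t - (0 * (u - s) + tr' t * (v - t))) with
      (((tr v - tr t) / (v - t) - tr' t) * (v - t)) by (field; lra).
    rewrite Rabs_mult; apply Rmult_le_compat; try apply Rabs_pos; [lra | apply Rmax_r]. }
assert (h1 := differentiable_pt_lim_proj1_0 exp s t (exp s) (derivable_pt_lim_exp s)).
generalize (differentiable_pt_lim_comp _ _ _ _ _ _ _ _ _ _ _ (hmul (exp s) (tr t)) h1 h2).
replace (tr t * exp s + exp s * 0) with (exp s * tr t) by ring.
replace (tr t * 0 + exp s * tr' t) with (exp s * tr' t) by ring.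
auto.
Qed.

Definition on_circle (z0 : C) (r t : R) : C :=
  (Re z0 + r * cos t, Im z0 + r * sin t).

Lemma Cmod_on_circle (z0 : C) (r t : R) : 0 <= r -> Cmod (on_circle z0 r t - z0) = r.
Proof.
intros hr; unfold Cmod, on_circle; simpl.
replace (_ + _) with (r ^ 2 * (sin t ^ 2 + cos t ^ 2)) by (destruct z0; simpl; ring).
generalize (sin2_cos2 t); unfold Rsqr; intros h.
replace (sin t ^ 2 + cos t ^ 2) with 1 by (rewrite <- h; ring).
rewrite Rmult_1_r; apply sqrt_pow2; auto.
Qed.

(** In the coordinates [z0 + exp (s + i t)] the form [Im g ds + Re g dt] is closed
    by the Cauchy-Riemann equations. Its circulation around
    [s1 <= s <= s2], [0 <= t <= 2 pi] vanishes, and the two horizontal sides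
    cancel by periodicity; so the mean of [Re g] over a circle does not depend on
    the radius, and tends to [Re (g z0)] for small radii. Only continuity is
    asked at the centre: this is what lets the exceptional points of
    [holomorphic_off] through. *)
Lemma circle_mean_value (g : C -> C) (z0 : C) (r : R) :
  0 < r -> Ccontinuous g z0 ->
  (forall z, 0 < Cmod (z - z0) <= r -> Cdifferentiable g z) ->
  ex_RInt (fun t => Re (g (on_circle z0 r t))) 0 (2 * PI) /\
  RInt (fun t => Re (g (on_circle z0 r t))) 0 (2 * PI) = 2 * PI * Re (g z0).
Proof.
intros hr hc hd.
set (A := fun s t => Im (g (on_circle z0 (exp s) t))).
set (B := fun s t => Re (g (on_circle z0 (exp s) t))).
assert (hpi := PI_RGT_0).
assert (hform : forall s t, s <= ln r -> closed_form_at A B s t).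
{ intros s t hs.
  assert (he : exp s <= r).
  { rewrite <- (exp_ln r hr); destruct hs as [hs | ->];
      [left; apply exp_increasing | right]; auto. }
  assert (he0 := exp_pos s).
  destruct (hd (on_circle z0 (exp s) t)) as [l hl].
  { rewrite Cmod_on_circle; lra. }
  apply is_derive_C_components in hl; destruct hl as [hRe hIm].
  assert (hx := differentiable_exp_trig (Re z0) cos (fun t => - sin t) s t
    (derivable_pt_lim_cos t)).
  assert (hy := differentiable_exp_trig (Im z0) sin cos s t (derivable_pt_lim_sin t)).
  generalize (differentiable_pt_lim_comp _ _ _ _ _ _ _ _ _ _ _ hRe hx hy).
  generalize (differentiable_pt_lim_comp _ _ _ _ _ _ _ _ _ _ _ hIm hx hy).
  intros k1 k2.
  eexists _, _, _; split; [exact k1 |].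
  match type of k1 with differentiable_pt_lim _ _ _ _ ?a =>
    match type of k2 with differentiable_pt_lim _ _ _ ?b _ =>
      replace a with b by ring end end.
  exact k2. }
assert (hBc : forall s t, s <= ln r -> continuous (fun t => B s t) t).
{ intros s t hs; destruct (hform s t hs) as (p & l & q & _ & h).
  exact (differentiable_continuous_r B s t l q h). }
assert (hconst : forall s, s <= ln r ->
  RInt (fun t => B (ln r) t) 0 (2 * PI) = RInt (fun t => B s t) 0 (2 * PI)).
{ intros s hs.
  assert (h := circulation_closed_form A B s (ln r) 0 (2 * PI) hs ltac:(lra)
    ltac:(intros; apply hform; lra)).
  unfold circulation in h.
  rewrite (RInt_ext (fun x => A x (2 * PI)) (fun x => A x 0)) in h.
  - lra.
  - intros x _; unfold A, on_circle.
    rewrite sin_2PI, cos_2PI, sin_0, cos_0; reflexivity. }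
assert (hBr : forall t, B (ln r) t = Re (g (on_circle z0 r t))).
{ intros t; unfold B; rewrite exp_ln by auto; reflexivity. }
split.
{ apply ex_RInt_ext with (fun t => B (ln r) t); [intros; apply hBr |].
  apply (ex_RInt_continuous (V := R_CompleteNormedModule) (fun t => B (ln r) t)).
  intros t _; apply hBc; lra. }
rewrite <- (RInt_ext _ _ _ _ (fun t _ => hBr t)).
assert (hclose : forall eps, 0 < eps ->
  Rabs (RInt (fun t => B (ln r) t) 0 (2 * PI) - Re (g z0) * (2 * PI - 0)) <=
    eps * (2 * PI - 0)).
{ intros eps heps.
  destruct (proj1 (Ccontinuous_eps g z0) hc eps heps) as (d & hd0 & hw).
  set (r' := Rmin (d / 2) r).
  assert (hr' : 0 < r') by (unfold r'; apply Rmin_case; lra).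
  assert (hr'd : r' < d) by (unfold r'; generalize (Rmin_l (d / 2) r); lra).
  assert (hs : ln r' <= ln r) by (apply ln_le; [auto | apply Rmin_r]).
  rewrite (hconst _ hs); apply RInt_near_constant; [lra | |].
  - intros t _; apply hBc; auto.
  - intros t _; unfold B; rewrite exp_ln by auto.
    apply Rle_trans with (Cmod (g (on_circle z0 r' t) - g z0)).
    + replace (Re _ - Re _) with (Re (g (on_circle z0 r' t) - g z0)%C)
        by (destruct (g (on_circle z0 r' t)), (g z0); simpl; ring).
      apply re_le_Cmod.
    + left; apply hw; rewrite Cmod_on_circle; lra. }
apply cond_eq; intros eps heps.
assert (h := hclose (eps / (4 * PI)) ltac:(apply Rdiv_lt_0_compat; lra)).
replace (eps / (4 * PI) * (2 * PI - 0)) with (eps / 2) in h by (field; lra).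
replace (2 * PI * Re (g z0)) with (Re (g z0) * (2 * PI - 0)) by ring.
eapply Rle_lt_trans; [exact h | lra].
Qed.

(** * The maximum principle *)

Lemma Cmod_sub_sym (z w : C) : Cmod (z - w) = Cmod (w - z).
Proof. rewrite <- Cmod_opp; f_equal; ring. Qed.

Lemma Cmod_triangle_sub (z w : C) : Cmod z <= Cmod w + Cmod (z - w).
Proof. replace z with (w + (z - w))%C at 1 by ring; apply Cmod_triangle. Qed.

Lemma Cconj_RtoC (x : R) : Cconj x = RtoC x.
Proof. apply injective_projections; simpl; ring. Qed.

Lemma unimodular_mul_conj (c : C) : Cmod c = 1 -> (c * Cconj c)%C = RtoC 1.
Proof. intros h; rewrite <- Cmod2_conj, h; f_equal; ring. Qed.

Lemma Cmod_le_abs_sum (z : C) : Cmod z <= Rabs (fst z) + Rabs (snd z).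
Proof.
destruct z as [x y]; simpl.
replace (x, y) with (RtoC x + RtoC y * Ci)%C by (apply injective_projections; simpl; ring).
eapply Rle_trans; [apply Cmod_triangle |].
rewrite Cmod_mult, !Cmod_R, Cmod_Ci; lra.
Qed.

(** If no maximum existed, by upper semicontinuity [v] would near each point stay
    below one of its own values, and [box_induction] would make this global.
    The statement proved by induction is phrased on boxes, and is void off the
    disk. *)
Lemma disk_maximum (v : C -> R) (r : R) : 0 <= r ->
  (forall z, Cmod z <= r -> forall eps, 0 < eps -> exists d, 0 < d /\
     forall w, Cmod (w - z) < d -> v w < v z + eps) ->
  exists m, Cmod m <= r /\ forall z, Cmod z <= r -> v z <= v m.
Proof.
intros hr hv; apply NNPP; intros hno.
assert (hup : forall q, Cmod q <= r -> exists q', Cmod q' <= r /\ v q < v q').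
{ intros q hq; apply NNPP; intros h; apply hno; exists q; split; auto.
  intros z hz; apply Rnot_lt_le; intros hlt; apply h; exists z; auto. }
assert (h0 : Cmod (RtoC 0) <= r) by (rewrite Cmod_0; auto).
destruct (box_induction (fun a b c d => exists q, Cmod q <= r /\
  forall x y, a <= x <= b -> c <= y <= d -> Cmod (x, y) <= r -> v (x, y) <= v q)
  (- r) r (- r) r) as [m [hm hmax]]; try lra.
- intros a b c d _ _ _ _ _ _.
  assert (two : forall q1 q2, Cmod q1 <= r -> Cmod q2 <= r ->
    exists q, Cmod q <= r /\ v q1 <= v q /\ v q2 <= v q).
  { intros q1 q2 h1 h2; destruct (Rle_dec (v q1) (v q2)).
    - exists q2; repeat split; auto; lra.
    - exists q1; repeat split; auto; lra. }
  intros (q1 & h1 & k1) (q2 & h2 & k2) (q3 & h3 & k3) (q4 & h4 & k4).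
  destruct (two q1 q2 h1 h2) as (q5 & h5 & e1 & e2).
  destruct (two q3 q4 h3 h4) as (q6 & h6 & e3 & e4).
  destruct (two q5 q6 h5 h6) as (q & hq & e5 & e6).
  exists q; split; auto; intros x y hx hy hxy.
  destruct (Rle_dec x ((a + b) / 2)), (Rle_dec y ((c + d) / 2)).
  + specialize (k1 x y ltac:(lra) ltac:(lra) hxy); lra.
  + specialize (k3 x y ltac:(lra) ltac:(lra) hxy); lra.
  + specialize (k2 x y ltac:(lra) ltac:(lra) hxy); lra.
  + specialize (k4 x y ltac:(lra) ltac:(lra) hxy); lra.
- intros x y hx hy.
  assert (near : forall d : R, 0 < d -> forall a b c e x' y' : R,
    a <= x -> x <= b -> c <= y -> y <= e -> b - a < d / 2 -> e - c < d / 2 ->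
    a <= x' <= b -> c <= y' <= e -> Cmod ((x', y') - (x, y)) < d).
  { intros d hd a b c e x' y' h1 h2 h3 h4 h5 h6 h7 h8.
    eapply Rle_lt_trans; [apply (Cmod_le_abs_sum) |]; simpl.
    assert (k1 : Rabs (x' + - x) < d / 2) by (apply Rabs_def1; lra).
    assert (k2 : Rabs (y' + - y) < d / 2) by (apply Rabs_def1; lra).
    lra. }
  destruct (Rle_dec (Cmod (x, y)) r) as [hin | hout].
  + destruct (hup _ hin) as (q & hq & hlt).
    destruct (hv _ hin (v q - v (x, y)) ltac:(lra)) as (d & hd & hw).
    exists (d / 2); split; [lra |].
    intros a b c e _ h1 h2 _ _ h3 h4 _ h5 h6; exists q; split; auto.
    intros x' y' hx' hy' _.
    specialize (hw (x', y') (near d hd a b c e x' y' h1 h2 h3 h4 h5 h6 hx' hy')); lra.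
  + assert (hd : 0 < Cmod (x, y) - r) by lra.
    exists ((Cmod (x, y) - r) / 2); split; [lra |].
    intros a b c e _ h1 h2 _ _ h3 h4 _ h5 h6; exists (RtoC 0); split; auto.
    intros x' y' hx' hy' hin; exfalso.
    generalize (near _ hd a b c e x' y' h1 h2 h3 h4 h5 h6 hx' hy').
    rewrite Cmod_sub_sym; generalize (Cmod_triangle_sub (x, y) (x', y')); lra.
- apply hno; exists m; split; auto; intros [x y] hz.
  assert (hxy := Rmax_Cmod (x, y)); simpl in hxy.
  assert (hx := Rmax_l (Rabs x) (Rabs y)); assert (hy := Rmax_r (Rabs x) (Rabs y)).
  apply hmax; auto; apply Rabs_le_between; lra.
Qed.

Lemma Ccontinuous_plus (g h : C -> C) (z : C) :
  Ccontinuous g z -> Ccontinuous h z -> Ccontinuous (fun w => g w + h w)%C z.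
Proof. exact (@continuous_plus C_metric C_AbsRing C_normed g h z). Qed.

Lemma Ccontinuous_mult (g h : C -> C) (z : C) :
  Ccontinuous g z -> Ccontinuous h z -> Ccontinuous (fun w => g w * h w)%C z.
Proof. exact (@continuous_mult C_metric C_AbsRing g h z). Qed.

Lemma Cdifferentiable_plus (g h : C -> C) (z : C) :
  Cdifferentiable g z -> Cdifferentiable h z -> Cdifferentiable (fun w => g w + h w)%C z.
Proof. exact (@ex_derive_plus C_AbsRing C_normed g h z). Qed.

Lemma Cdifferentiable_mult (g h : C -> C) (z : C) :
  Cdifferentiable g z -> Cdifferentiable h z -> Cdifferentiable (fun w => g w * h w)%C z.
Proof.
intros [l hl] [m hm]; eexists.
exact (@is_derive_mult C_AbsRing g h z l m hl hm Cmult_comm).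
Qed.

Lemma Cdifferentiable_const (c z : C) : Cdifferentiable (fun _ => c) z.
Proof. exact (@ex_derive_const C_AbsRing C_normed c z). Qed.

Lemma Cdifferentiable_id (z : C) : Cdifferentiable (fun w => w) z.
Proof. exact (@ex_derive_id C_AbsRing z). Qed.

Lemma Cdifferentiable_comp (g h : C -> C) (z : C) :
  Cdifferentiable g (h z) -> Cdifferentiable h z -> Cdifferentiable (fun w => g (h w)) z.
Proof.
intros [l hl] [m hm]; eexists.
exact (@is_derive_comp C_AbsRing C_normed g h z l m hl hm).
Qed.

Lemma Cdifferentiable_continuous (g : C -> C) (z : C) :
  Cdifferentiable g z -> Ccontinuous g z.
Proof. exact (@ex_derive_continuous C_AbsRing C_normed g z). Qed.

Lemma Cdifferentiable_inv (z : C) : z <> RtoC 0 -> Cdifferentiable Cinv z.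
Proof.
intros hz; assert (hz' := proj1 (Cmod_gt_0 z) hz).
exists (- / (z * z))%C; apply is_derive_C_eps; intros eps heps.
set (m := Cmod z) in *.
exists (Rmin (m / 2) (eps * m ^ 3 / 2)); split.
{ apply Rmin_case; [lra |].
  assert (0 < eps * m ^ 3) by (apply Rmult_lt_0_compat; [lra | apply pow_lt; lra]); lra. }
intros w hw.
assert (h1 := Rmin_l (m / 2) (eps * m ^ 3 / 2)).
assert (h2 := Rmin_r (m / 2) (eps * m ^ 3 / 2)).
assert (hmw : m / 2 < Cmod w).
{ generalize (Cmod_triangle_sub z w); rewrite Cmod_sub_sym; fold m; lra. }
assert (hw0 : w <> RtoC 0) by (apply Cmod_gt_0; lra).
replace (/ w - / z - - / (z * z) * (w - z))%C with
  ((w - z) / (w * (z * z)) * (w - z))%C by (field; auto).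
rewrite Cmod_mult; apply Rmult_le_compat_r; [apply Cmod_ge_0 |].
rewrite Cmod_div, !Cmod_mult by (repeat apply Cmult_neq_0; auto); fold m.
apply Rle_div_l.
{ repeat apply Rmult_lt_0_compat; lra. }
apply Rle_trans with (eps * (m / 2 * (m * m))).
- left; apply Rlt_le_trans with (1 := hw); eapply Rle_trans; [exact h2 |]; right; field.
- apply Rmult_le_compat_l; [lra |]; apply Rmult_le_compat_r; nra.
Qed.

Lemma Cdifferentiable_div (g h : C -> C) (z : C) : h z <> RtoC 0 ->
  Cdifferentiable g z -> Cdifferentiable h z -> Cdifferentiable (fun w => g w / h w)%C z.
Proof.
intros h0 hg hh; apply Cdifferentiable_mult; auto.
apply (Cdifferentiable_comp Cinv h); auto; apply Cdifferentiable_inv; auto.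
Qed.

Lemma Ccontinuous_div (g h : C -> C) (z : C) : h z <> RtoC 0 ->
  Ccontinuous g z -> Ccontinuous h z -> Ccontinuous (fun w => g w / h w)%C z.
Proof.
intros h0 hg hh; apply Ccontinuous_mult; auto.
apply (@continuous_comp C_metric C_metric C_metric h Cinv); auto.
apply Cdifferentiable_continuous, Cdifferentiable_inv; auto.
Qed.

Lemma Cdifferentiable_ext_near (g h : C -> C) (z : C) :
  (exists d, 0 < d /\ forall w, Cmod (w - z) < d -> g w = h w) ->
  Cdifferentiable g z -> Cdifferentiable h z.
Proof.
intros hd; apply (@ex_derive_ext_loc C_AbsRing C_normed g h z).
apply (proj2 (locally_metric z _)); exact hd.
Qed.

Lemma Ccontinuous_ext_near (g h : C -> C) (z : C) :
  (exists d, 0 < d /\ forall w, Cmod (w - z) < d -> g w = h w) ->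
  Ccontinuous g z -> Ccontinuous h z.
Proof.
intros hd; apply (@continuous_ext_loc C_metric C_metric).
apply (proj2 (locally_metric z _)); destruct hd as (d & h0 & hd).
exists d; split; auto; intros; symmetry; auto.
Qed.

(** [Re (g z0)] is the mean of [Re g] over the circle, so [Re g] cannot lie below it
    by a fixed margin everywhere. *)
Lemma circle_not_below (g : C -> C) (z0 : C) (r e : R) :
  0 < r -> 0 < e -> Ccontinuous g z0 ->
  (forall z, 0 < Cmod (z - z0) <= r -> Cdifferentiable g z) ->
  exists z, Cmod (z - z0) = r /\ Re (g z0) - e < Re (g z).
Proof.
intros hr he hc hd; apply NNPP; intros hno.
destruct (circle_mean_value g z0 r hr hc hd) as [hi hm].
assert (hpi := PI_RGT_0).
assert (hle : RInt (fun t => Re (g (on_circle z0 r t))) 0 (2 * PI) <=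
  RInt (fun _ => Re (g z0) - e) 0 (2 * PI)).
{ apply RInt_le; auto; [lra | apply ex_RInt_const |].
  intros t _; apply Rnot_lt_le; intros hlt; apply hno.
  exists (on_circle z0 r t); split; auto; apply Cmod_on_circle; lra. }
rewrite hm, RInt_const in hle; unfold scal in hle; simpl in hle; unfold mult in hle;
  simpl in hle; nra.
Qed.

Lemma separated_from_list (S : list C) (z : C) :
  exists d, 0 < d /\ forall w, 0 < Cmod (w - z) <= d -> ~ In w S.
Proof.
induction S as [|s S IH]; [exists 1; split; [lra | intros w _ []] |].
destruct IH as (d & hd & h).
destruct (Req_dec (Cmod (s - z)) 0) as [e | e].
- exists d; split; auto; intros w hw [<- | hin]; [lra | exact (h w hw hin)].
- assert (hs := Cmod_ge_0 (s - z)).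
  exists (Rmin d (Cmod (s - z) / 2)); split; [apply Rmin_case; lra |].
  assert (h1 := Rmin_l d (Cmod (s - z) / 2)); assert (h2 := Rmin_r d (Cmod (s - z) / 2)).
  intros w hw [<- | hin]; [lra | apply (h w); auto; lra].
Qed.

(** The class in which the difference quotients of the Schwarz-Pick lemma live: they
    are continuous at the base points of the quotients, and differentiability
    there is not asserted. *)
Definition holomorphic_off (S : list C) (g : C -> C) : Prop :=
  forall z, disk z -> Ccontinuous g z /\ (~ In z S -> Cdifferentiable g z).

(** At an interior maximum [m] of [|g| + e |z|^2], rotate [g] so that [g m] is
    positive. Since [|z|^2 = |m|^2 + 2 Re (conj m (z - m)) + |z - m|^2], the
    function [G = xi g + 2 e conj m (z - m)] has real part at most
    [Re (G m) - e s^2] all over the circle of radius [s] about [m], against the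
    mean value property. *)
Lemma maximum_principle (S : list C) (g : C -> C) :
  holomorphic_off S g ->
  (forall M, 1 < M -> exists R0, R0 < 1 /\
     forall z, R0 < Cmod z < 1 -> Cmod (g z) <= M) ->
  forall z, disk z -> Cmod (g z) <= 1.
Proof.
intros hg hb z0 hz0; apply Rnot_lt_le; intros hgt; unfold disk in hz0.
set (e := (Cmod (g z0) - 1) / 4).
assert (he : 0 < e) by (unfold e; lra).
destruct (hb (1 + e) ltac:(lra)) as (R0 & hR0 & hM).
assert (hm1 := Rmax_l R0 (Cmod z0)); assert (hm2 := Rmax_r R0 (Cmod z0)).
set (r := (Rmax R0 (Cmod z0) + 1) / 2).
assert (hmax1 : Rmax R0 (Cmod z0) < 1) by (apply Rmax_case; auto).
assert (hr1 : r < 1) by (unfold r; lra).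
assert (hrz : Cmod z0 < r) by (unfold r; lra).
assert (hrR : R0 < r) by (unfold r; lra).
assert (h0 := Cmod_ge_0 z0).
destruct (disk_maximum (fun z => Cmod (g z) + e * Cmod z ^ 2) r) as (m & hm & hmax);
  [lra | |].
{ intros z hz eps heps.
  destruct (hg z ltac:(unfold disk; lra)) as [hc _].
  destruct (proj1 (Ccontinuous_eps g z) hc (eps / 2) ltac:(lra)) as (d & hd & hw).
  assert (hd2 : 0 < eps / (6 * (e + 1))) by (apply Rdiv_lt_0_compat; lra).
  exists (Rmin d (Rmin 1 (eps / (6 * (e + 1))))); split.
  { repeat apply Rmin_case; lra. }
  intros w hwz.
  assert (k1 := Rmin_l d (Rmin 1 (eps / (6 * (e + 1))))).
  assert (k2 := Rmin_r d (Rmin 1 (eps / (6 * (e + 1))))).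
  assert (k3 := Rmin_l 1 (eps / (6 * (e + 1)))).
  assert (k4 := Rmin_r 1 (eps / (6 * (e + 1)))).
  specialize (hw w ltac:(lra)).
  generalize (Cmod_triangle_sub (g w) (g z)) (Cmod_triangle_sub w z).
  generalize (Cmod_ge_0 w) (Cmod_ge_0 z).
  intros p1 p2 p3 p4.
  assert (p5 : Cmod (w - z) * (6 * (e + 1)) < eps).
  { apply Rlt_div_r; lra. }
  assert (p8 := Cmod_ge_0 (w - z)).
  assert (p6 : Cmod w ^ 2 <= Cmod z ^ 2 + 3 * Cmod (w - z)).
  { apply Rle_trans with ((Cmod z + Cmod (w - z)) ^ 2); [apply pow_incr; lra |]; nra. }
  assert (p7 : e * Cmod w ^ 2 <= e * (Cmod z ^ 2 + 3 * Cmod (w - z)))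
    by (apply Rmult_le_compat_l; lra).
  nra. }
assert (hv := hmax z0 ltac:(lra)); simpl in hv.
assert (hmr : Cmod m < r).
{ destruct hm as [hm | hm]; auto; exfalso.
  assert (k := hM m ltac:(lra)); rewrite hm in hv.
  assert (r ^ 2 <= 1) by nra; unfold e in *; nra. }
assert (hm0 := Cmod_ge_0 m).
assert (hgm : 0 < Cmod (g m)).
{ assert (Cmod m ^ 2 <= 1) by nra; unfold e in *; nra. }
destruct (separated_from_list S m) as (d & hd & hS).
(* the circle of radius [s] about [m] stays in the disk of radius [r] and avoids
   the exceptional points other than [m] *)
set (s := Rmin d (r - Cmod m)).
assert (hs : 0 < s) by (unfold s; apply Rmin_case; lra).
assert (hs1 : s <= d) by apply Rmin_l.
assert (hs2 : s <= r - Cmod m) by apply Rmin_r.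
set (xi := (Cconj (g m) / Cmod (g m))%C).
assert (hxi : Cmod xi = 1).
{ unfold xi; rewrite Cmod_div, Cmod_conj, Cmod_R.
  - rewrite Rabs_pos_eq by lra; field; lra.
  - intros h; apply RtoC_inj in h; lra. }
set (G := fun z => (xi * g z + (2 * e * Cconj m) * (z - m))%C).
assert (haff : forall z, Cdifferentiable (fun z => (2 * e * Cconj m) * (z - m))%C z).
{ intros z; apply (Cdifferentiable_mult (fun _ => (2 * e * Cconj m)%C));
    [apply Cdifferentiable_const |].
  apply (Cdifferentiable_plus (fun z => z)); [apply Cdifferentiable_id |].
  apply Cdifferentiable_const. }
destruct (circle_not_below G m s (e * s ^ 2)) as (z & hz & hlt); auto.
- apply Rmult_lt_0_compat; [lra | apply pow_lt; lra].
- apply Ccontinuous_plus; [| apply Cdifferentiable_continuous, haff].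
  apply (Ccontinuous_mult (fun _ => xi));
    [apply Cdifferentiable_continuous, Cdifferentiable_const |].
  apply hg; unfold disk; lra.
- intros z hz; apply Cdifferentiable_plus; [| apply haff].
  apply (Cdifferentiable_mult (fun _ => xi)); [apply Cdifferentiable_const |].
  apply hg; [| apply hS; lra].
  unfold disk; generalize (Cmod_triangle_sub z m); lra.
- assert (hGm : Re (G m) = Cmod (g m)).
  { unfold G; replace (xi * g m + 2 * e * Cconj m * (m - m))%C with (RtoC (Cmod (g m))).
    - reflexivity.
    - unfold xi; field_simplify; [| intros h; apply RtoC_inj in h; lra].
      rewrite Cmult_comm, <- Cmod2_conj, RtoC_pow; field.
      intros h; apply RtoC_inj in h; lra. }
  assert (hGz : Re (G z) <= Cmod (g z) + 2 * e * Re (Cconj m * (z - m))%C).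
  { replace (Re (G z)) with (Re (xi * g z)%C + 2 * e * Re (Cconj m * (z - m))%C)
      by (unfold G; generalize (xi * g z)%C; intros [u v]; destruct m, z; simpl; ring).
    apply Rplus_le_compat_r; rewrite <- (Rmult_1_l (Cmod (g z))), <- hxi, <- Cmod_mult.
    eapply Rle_trans; [apply Rle_abs | apply re_le_Cmod]. }
  assert (hsq : Cmod z ^ 2 = Cmod m ^ 2 + 2 * Re (Cconj m * (z - m))%C + s ^ 2).
  { rewrite <- hz, !Cmod2_alt; destruct m, z; simpl; ring. }
  assert (hle := hmax z ltac:(generalize (Cmod_triangle_sub z m); lra)); cbv beta in hle.
  rewrite hsq in hle; lra.
Qed.

(** * The Schwarz-Pick lemma *)

Lemma pseudo_hyperbolic_identity (a b : C) :
  Cmod (1 - Cconj b * a)%C ^ 2 - Cmod (a - b) ^ 2 =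
  (1 - Cmod a ^ 2) * (1 - Cmod b ^ 2).
Proof. rewrite !Cmod2_alt; destruct a, b; simpl; ring. Qed.

Lemma sqr_le_of_le (x y : R) : 0 <= y -> x ^ 2 <= y ^ 2 -> x <= y.
Proof. intros hy h; apply Rnot_lt_le; intros hlt; nra. Qed.

Lemma Cmod_lt1_sqr (a : C) : Cmod a < 1 -> Cmod a ^ 2 < 1.
Proof. intros h; assert (h0 := Cmod_ge_0 a); nra. Qed.

Lemma Cmod_le1_sqr (a : C) : Cmod a <= 1 -> Cmod a ^ 2 <= 1.
Proof. intros h; assert (h0 := Cmod_ge_0 a); nra. Qed.

Lemma one_minus_conj_mul_ge (a b : C) : Cmod a <= 1 ->
  1 - Cmod b <= Cmod (1 - Cconj b * a)%C.
Proof.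
intros ha.
assert (h := Cmod_triangle_sub 1 (Cconj b * a)%C).
rewrite Cmod_1, Cmod_mult, Cmod_conj in h.
assert (hb := Cmod_ge_0 b); assert (h2 : Cmod b * Cmod a <= Cmod b * 1)
  by (apply Rmult_le_compat_l; auto).
lra.
Qed.

Lemma one_minus_conj_mul_neq0 (a b : C) : Cmod a <= 1 -> Cmod b < 1 ->
  (1 - Cconj b * a)%C <> RtoC 0.
Proof.
intros ha hb h; assert (h1 := one_minus_conj_mul_ge a b ha).
rewrite h, Cmod_0 in h1; lra.
Qed.

Lemma Csub_neq0 (z w : C) : z <> w -> (z - w)%C <> RtoC 0.
Proof. intros h h'; apply h; replace z with (z - w + w)%C by ring; rewrite h'; ring. Qed.

(** The function [k] is the quotient of the pseudo-hyperbolic difference of values by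
    that of points, filled in by the derivative at [w]. It lies again in the class
    [holomorphic_off], and near the unit circle it is bounded by [1 / rho z w],
    which tends to 1; the maximum principle does the rest. *)
Lemma schwarz_pick_quotient (S : list C) (g : C -> C) (w : C) :
  holomorphic_off S g -> (forall z, disk z -> Cmod (g z) < 1) ->
  disk w -> ~ In w S ->
  exists k, holomorphic_off (w :: S) k /\ (forall z, disk z -> Cmod (k z) <= 1) /\
    forall z, disk z ->
      ((g z - g w) * (1 - Cconj w * z) =
       k z * (z - w) * (1 - Cconj (g w) * g z))%C.
Proof.
intros hg hg1 hw hwS; destruct (proj2 (hg w hw) hwS) as [l hl].
set (q := fun z => if excluded_middle_informative (z = w) then l
                   else ((g z - g w) / (z - w))%C).
set (k := fun z => (q z * ((1 - Cconj w * z) / (1 - Cconj (g w) * g z)))%C).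
assert (hq : forall z, z <> w -> q z = ((g z - g w) / (z - w))%C).
{ intros z hz; unfold q; destruct (excluded_middle_informative (z = w)); tauto. }
assert (hden : forall z, disk z -> (1 - Cconj (g w) * g z)%C <> RtoC 0).
{ intros z hz; apply one_minus_conj_mul_neq0; auto; left; auto. }
assert (hcst : forall c z, Ccontinuous (fun _ => c) z)
  by (intros; apply Cdifferentiable_continuous, Cdifferentiable_const).
assert (hlin : forall a b z, Cdifferentiable (fun z => a + b * z)%C z).
{ intros a b z; apply (Cdifferentiable_plus (fun _ => a)); [apply Cdifferentiable_const |].
  apply (Cdifferentiable_mult (fun _ => b));
    [apply Cdifferentiable_const | apply Cdifferentiable_id]. }
assert (hnum : forall z, Cdifferentiable (fun z => 1 - Cconj w * z)%C z).
{ intros z; apply (Cdifferentiable_ext_near (fun z => 1 + - Cconj w * z)%C); [| apply hlin].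
  exists 1; split; [lra | intros; ring]. }
assert (hsub : forall z, Cdifferentiable (fun z => z - w)%C z).
{ intros z; apply (Cdifferentiable_ext_near (fun z => - w + 1 * z)%C); [| apply hlin].
  exists 1; split; [lra | intros; ring]. }
assert (hdenD : forall z, Cdifferentiable g z ->
  Cdifferentiable (fun z => 1 - Cconj (g w) * g z)%C z).
{ intros z hz; apply (Cdifferentiable_ext_near (fun z => 1 + - Cconj (g w) * g z)%C).
  - exists 1; split; [lra | intros; ring].
  - apply (Cdifferentiable_comp (fun y => 1 + - Cconj (g w) * y)%C g); auto. }
assert (hdenC : forall z, Ccontinuous g z ->
  Ccontinuous (fun z => 1 - Cconj (g w) * g z)%C z).
{ intros z hz; apply (Ccontinuous_ext_near (fun z => 1 + - Cconj (g w) * g z)%C).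
  - exists 1; split; [lra | intros; ring].
  - apply (Ccontinuous_plus (fun _ => RtoC 1)); auto.
    apply (Ccontinuous_mult (fun _ => (- Cconj (g w))%C)); auto. }
assert (hk : holomorphic_off (w :: S) k).
{ intros z hz; destruct (hg z hz) as [hc hd].
  destruct (excluded_middle_informative (z = w)) as [-> | hzw].
  - split; [| simpl; tauto].
    apply Ccontinuous_mult; [| apply Ccontinuous_div; auto;
      apply Cdifferentiable_continuous; auto].
    apply Ccontinuous_eps; intros eps heps.
    destruct (proj1 (is_derive_C_eps g w l) hl (eps / 2) ltac:(lra)) as (d & hd0 & hdl).
    exists d; split; auto; intros y hy; specialize (hdl y hy).
    unfold q; destruct (excluded_middle_informative (w = w)) as [_ | n]; [| tauto].
    destruct (excluded_middle_informative (y = w)) as [_ | n].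
    + replace (l - l)%C with (RtoC 0) by ring; rewrite Cmod_0; lra.
    + assert (n' := Csub_neq0 y w n); assert (n2 := proj1 (Cmod_gt_0 _) n').
      replace ((g y - g w) / (y - w) - l)%C with
        ((g y - g w - l * (y - w)) / (y - w))%C by (field; auto).
      rewrite Cmod_div by auto; apply Rlt_div_l; [auto | nra].
  - assert (hnear : forall h : C -> C, h = (fun y => (g y - g w) / (y - w) *
        ((1 - Cconj w * y) / (1 - Cconj (g w) * g y)))%C ->
      exists d, 0 < d /\ forall y, Cmod (y - z) < d -> h y = k y).
    { intros h ->; exists (Cmod (z - w)); split; [apply Cmod_gt_0, Csub_neq0; auto |].
      intros y hy; unfold k; rewrite hq; auto.
      intros ->; rewrite Cmod_sub_sym in hy; lra. }
    assert (hzw' := Csub_neq0 z w hzw).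
    split.
    + eapply Ccontinuous_ext_near; [apply hnear; reflexivity |].
      apply Ccontinuous_mult; apply Ccontinuous_div; auto;
        try (apply Cdifferentiable_continuous; solve [auto]).
      apply (Ccontinuous_plus g (fun _ => (- g w)%C)); auto.
    + intros hzS; assert (hdz : Cdifferentiable g z) by (apply hd; simpl in hzS; tauto).
      eapply Cdifferentiable_ext_near; [apply hnear; reflexivity |].
      apply Cdifferentiable_mult; apply Cdifferentiable_div; auto.
      apply (Cdifferentiable_plus g (fun _ => (- g w)%C)); auto;
        apply Cdifferentiable_const. }
assert (heq : forall z, disk z -> ((g z - g w) * (1 - Cconj w * z) =
       k z * (z - w) * (1 - Cconj (g w) * g z))%C).
{ intros z hz; unfold k.
  destruct (excluded_middle_informative (z = w)) as [-> | hzw]; [ring |].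
  rewrite hq by auto; assert (hzw' := Csub_neq0 z w hzw); field; auto. }
exists k; repeat split; auto; try apply hk; auto.
intros z hz; revert z hz.
apply (maximum_principle (w :: S) k hk); intros M hM.
unfold disk in hw; assert (hw2 := Cmod_lt1_sqr w hw); assert (hw0 := Cmod_ge_0 w).
assert (hM1 : / M < 1) by (rewrite <- Rinv_1; apply Rinv_lt_contravar; lra).
assert (hM0 : 0 < / M) by (apply Rinv_0_lt_compat; lra).
assert (hdelta : 0 < (1 - (/ M) ^ 2) * (1 - Cmod w) ^ 2).
{ apply Rmult_lt_0_compat; [nra | apply pow_lt; lra]. }
exists (1 - (1 - (/ M) ^ 2) * (1 - Cmod w) ^ 2 / 2); split; [lra |].
intros z [hz1 hz2].
assert (hz0 := Cmod_ge_0 z).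
assert (h1 := pseudo_hyperbolic_identity z w).
assert (h2 := pseudo_hyperbolic_identity (g z) (g w)).
assert (h3 := one_minus_conj_mul_ge z w ltac:(lra)).
assert (hgz := hg1 z hz2); assert (hgw := hg1 w hw).
assert (h4 := f_equal Cmod (heq z hz2)); rewrite !Cmod_mult in h4.
assert (hgz2 := Cmod_lt1_sqr _ hgz); assert (hgw2 := Cmod_lt1_sqr _ hgw).
assert (hB := proj1 (Cmod_gt_0 _) (hden z hz2)).
set (W := Cmod (1 - Cconj w * z)%C) in *.
set (B := Cmod (1 - Cconj (g w) * g z)%C) in *.
set (Z := Cmod (z - w)) in *.
set (A := Cmod (g z - g w)) in *.
assert (hA : A <= B).
{ apply sqr_le_of_le; [lra |].
  assert (0 < (1 - Cmod (g z) ^ 2) * (1 - Cmod (g w) ^ 2))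
    by (apply Rmult_lt_0_compat; lra); lra. }
assert (hA0 : 0 <= A) by apply Cmod_ge_0.
assert (hZ0 : 0 <= Z) by apply Cmod_ge_0.
assert (hk0 : 0 <= Cmod (k z)) by apply Cmod_ge_0.
assert (hWZ : W * / M <= Z).
{ apply sqr_le_of_le; auto.
  assert (k1 : 1 - Cmod z ^ 2 <= (1 - (/ M) ^ 2) * (1 - Cmod w) ^ 2) by nra.
  assert (k2 : (1 - Cmod w) ^ 2 <= W ^ 2) by (apply pow_incr; lra).
  assert (k3 : (1 - Cmod z ^ 2) * (1 - Cmod w ^ 2) <= (1 - (/ M) ^ 2) * (1 - Cmod w) ^ 2).
  { assert (0 <= 1 - Cmod z ^ 2) by nra.
    assert (0 <= Cmod w ^ 2) by apply pow2_ge_0. nra. }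
  assert (k4 : (1 - (/ M) ^ 2) * (1 - Cmod w) ^ 2 <= (1 - (/ M) ^ 2) * W ^ 2)
    by (apply Rmult_le_compat_l; [nra | auto]).
  rewrite Rpow_mult_distr; lra. }
assert (hZ : 0 < Z) by (assert (0 < W * / M) by (apply Rmult_lt_0_compat; lra); lra).
assert (hWM : W <= M * Z).
{ replace W with (M * (W * / M)) by (field; lra); apply Rmult_le_compat_l; lra. }
apply Rmult_le_reg_r with (Z * B); [apply Rmult_lt_0_compat; auto |].
replace (Cmod (k z) * (Z * B)) with (A * W) by lra.
replace (M * (Z * B)) with (B * (M * Z)) by ring.
apply Rmult_le_compat; lra.
Qed.

(** The values are allowed to have modulus 1, so the quotient lemma is applied to
    [s g] with [s < 1], and then [s] tends to 1. *)
Lemma schwarz_pick (S : list C) (g : C -> C) (z w : C) :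
  holomorphic_off S g -> (forall z, disk z -> Cmod (g z) <= 1) ->
  disk z -> disk w -> ~ In w S ->
  Cmod (g z - g w) * Cmod (1 - Cconj w * z)%C <=
  Cmod (z - w) * Cmod (1 - Cconj (g w) * g z)%C.
Proof.
intros hg hg1 hz hw hwS.
set (X := Cmod (g z - g w) * Cmod (1 - Cconj w * z)%C).
set (Y := Cmod (z - w)).
set (c := (Cconj (g w) * g z)%C).
assert (hX : 0 <= X) by (apply Rmult_le_pos; apply Cmod_ge_0).
assert (hY : 0 <= Y) by apply Cmod_ge_0.
assert (hc : Cmod c <= 1).
{ unfold c; rewrite Cmod_mult, Cmod_conj.
  generalize (hg1 z hz) (hg1 w hw) (Cmod_ge_0 (g z)) (Cmod_ge_0 (g w)); nra. }
assert (key : forall s, 0 < s < 1 -> s * X <= Y * (Cmod (1 - c) + (1 - s ^ 2))).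
{ intros s hs.
  assert (hmod : forall y, Cmod (s * g y)%C = s * Cmod (g y)).
  { intros y; rewrite Cmod_mult, Cmod_R, Rabs_pos_eq; lra. }
  destruct (schwarz_pick_quotient S (fun y => s * g y)%C w) as (k & _ & hk1 & hk); auto.
  - intros y hy; destruct (hg y hy) as [h1 h2]; split.
    + apply (Ccontinuous_mult (fun _ => RtoC s)); auto.
      apply Cdifferentiable_continuous, Cdifferentiable_const.
    + intros hyS; apply (Cdifferentiable_mult (fun _ => RtoC s)); auto.
      apply Cdifferentiable_const.
  - intros y hy; rewrite hmod; generalize (hg1 y hy) (Cmod_ge_0 (g y)); nra.
  - assert (h := f_equal Cmod (hk z hz)); specialize (hk1 z hz).
    replace (s * g z - s * g w)%C with (s * (g z - g w))%C in h by ring.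
    rewrite !Cmod_mult, Cmod_R, Rabs_pos_eq in h by lra.
    fold Y in h; unfold X; rewrite <- Rmult_assoc, h.
    apply Rle_trans with (1 * Y * Cmod (1 - Cconj (s * g w) * (s * g z))%C).
    + apply Rmult_le_compat_r; [apply Cmod_ge_0 |]; apply Rmult_le_compat_r; auto.
    + rewrite Rmult_1_l; apply Rmult_le_compat_l; auto.
      replace (1 - Cconj (s * g w) * (s * g z))%C with
        (1 - c + RtoC (1 - s ^ 2) * c)%C.
      * eapply Rle_trans; [apply Cmod_triangle |].
        rewrite Cmod_mult, Cmod_R, Rabs_pos_eq by nra.
        assert (0 <= 1 - s ^ 2) by nra; nra.
      * unfold c; rewrite Cmult_conj, RtoC_minus, RtoC_pow.
        rewrite Cconj_RtoC; ring. }
apply Rnot_lt_le; intros hlt; fold Y c in hlt.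
set (e := X - Y * Cmod (1 - c)) in *.
assert (he : 0 < e) by (unfold e; lra).
(* with [s = 1 - t] the loss is at most [t (X + 2 Y)], hence below [e] *)
set (t := e / (X + 2 * Y + e + 1)).
assert (ht : 0 < t < 1).
{ unfold t; split; [apply Rdiv_lt_0_compat; lra | apply Rlt_div_l; lra]. }
assert (ht2 : t * (X + 2 * Y + e + 1) = e) by (unfold t; field; lra).
specialize (key (1 - t) ltac:(lra)); unfold e in *; nra.
Qed.

(** * Automorphisms of the disk *)

(** The disk automorphism sending [0] to [a]; its inverse is [mobius (- a)]. *)
Definition mobius (a w : C) : C := ((w + a) / (1 + Cconj a * w))%C.

Lemma mobius_den_neq0 (a w : C) : disk a -> Cmod w <= 1 ->
  (1 + Cconj a * w)%C <> RtoC 0.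
Proof.
intros ha hw h; apply (one_minus_conj_mul_neq0 w (- a)%C); auto.
- rewrite Cmod_opp; exact ha.
- rewrite <- h, Copp_conj; ring.
Qed.

Lemma mobius_defect (a w : C) : disk a -> disk w ->
  1 - Cmod (mobius a w) ^ 2 =
  (1 - Cmod a ^ 2) * (1 - Cmod w ^ 2) / Cmod (1 + Cconj a * w)%C ^ 2.
Proof.
intros ha hw; assert (hn := mobius_den_neq0 a w ha (Rlt_le _ _ hw)).
assert (hp := proj1 (Cmod_gt_0 _) hn).
unfold mobius; rewrite Cmod_div by auto.
assert (h := pseudo_hyperbolic_identity w (- a)%C).
rewrite Copp_conj, Cmod_opp in h.
replace (1 - - Cconj a * w)%C with (1 + Cconj a * w)%C in h by ring.
replace (w - - a)%C with (w + a)%C in h by ring.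
rewrite Rmult_comm, <- h; field; lra.
Qed.

Lemma mobius_disk (a w : C) : disk a -> disk w -> disk (mobius a w).
Proof.
intros ha hw; assert (h := mobius_defect a w ha hw).
assert (hn := mobius_den_neq0 a w ha (Rlt_le _ _ hw)).
assert (hp := proj1 (Cmod_gt_0 _) hn).
assert (h1 := Cmod_lt1_sqr a ha); assert (h2 := Cmod_lt1_sqr w hw).
assert (h3 : 0 < 1 - Cmod (mobius a w) ^ 2).
{ rewrite h; apply Rdiv_lt_0_compat; [apply Rmult_lt_0_compat; lra | apply pow_lt; lra]. }
unfold disk; assert (h4 := Cmod_ge_0 (mobius a w)); nra.
Qed.

Lemma disk_opp (a : C) : disk a -> disk (- a)%C.
Proof. unfold disk; rewrite Cmod_opp; auto. Qed.

Lemma mobius_0 (a : C) : mobius a 0 = a.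
Proof. unfold mobius; field; rewrite Cmult_0_r, Cplus_0_r; intros h; injection h; lra. Qed.

Lemma one_minus_sqr_neq0 (a : C) : disk a -> (1 - Cconj a * a)%C <> RtoC 0.
Proof. intros ha; apply one_minus_conj_mul_neq0; [left|]; apply ha. Qed.

Lemma mobius_cancel (a w : C) : disk a -> disk w -> mobius (- a) (mobius a w) = w.
Proof.
intros ha hw; assert (hn := mobius_den_neq0 a w ha (Rlt_le _ _ hw)).
assert (ha' := one_minus_sqr_neq0 a ha).
unfold mobius; rewrite Copp_conj; field; split; auto.
intros h; apply ha'; rewrite <- h; ring.
Qed.

Lemma mobius_cancel' (a w : C) : disk a -> disk w -> mobius a (mobius (- a) w) = w.
Proof.
intros ha hw; assert (h := mobius_cancel (- a) w (disk_opp a ha) hw).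
replace (- - a)%C with a in h by ring; exact h.
Qed.

(** Solving [(y - a) / (1 - conj a y) = w] for [y]. *)
Lemma mobius_eq_of_quotient (a w y : C) : disk a -> disk w ->
  (y - a = w * (1 - Cconj a * y))%C -> y = mobius a w.
Proof.
intros ha hw h; assert (hn := mobius_den_neq0 a w ha (Rlt_le _ _ hw)).
assert (h' : (y * (1 + Cconj a * w) = w + a)%C).
{ replace (y * (1 + Cconj a * w))%C with (y - a + a + Cconj a * w * y)%C by ring.
  rewrite h; ring. }
unfold mobius; rewrite <- h'; field; auto.
Qed.

Lemma mobius_sub_center (a w : C) : disk a -> disk w ->
  (mobius a w - a = w * (1 - Cconj a * mobius a w))%C.
Proof.
intros ha hw; assert (hn := mobius_den_neq0 a w ha (Rlt_le _ _ hw)).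
unfold mobius; field; auto.
Qed.

(** Invariance of the pseudo-hyperbolic distance, without quotients. *)
Lemma mobius_isometry (a v w : C) : disk a -> disk v -> disk w ->
  Cmod (mobius a w - mobius a v) * Cmod (1 - Cconj v * w)%C =
  Cmod (w - v) * Cmod (1 - Cconj (mobius a v) * mobius a w)%C.
Proof.
intros ha hv hw.
assert (hnv := mobius_den_neq0 a v ha (Rlt_le _ _ hv)).
assert (hnw := mobius_den_neq0 a w ha (Rlt_le _ _ hw)).
assert (hnv' : (1 + a * Cconj v)%C <> RtoC 0).
{ intros h; apply hnv; rewrite <- (Cconj_conj (1 + Cconj a * v)%C).
  replace (Cconj (1 + Cconj a * v)%C) with (1 + a * Cconj v)%C.
  - rewrite h; apply Cconj_RtoC.
  - rewrite Cplus_conj, Cmult_conj, Cconj_conj, Cconj_RtoC; reflexivity. }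
assert (hmod : Cmod (1 + a * Cconj v)%C = Cmod (1 + Cconj a * v)%C).
{ rewrite <- Cmod_conj, Cplus_conj, Cmult_conj, Cconj_conj, Cconj_RtoC; reflexivity. }
assert (h1 : (mobius a w - mobius a v = (w - v) * (1 - Cconj a * a) /
  ((1 + Cconj a * w) * (1 + Cconj a * v)))%C).
{ unfold mobius; field; auto. }
assert (h2 : (1 - Cconj (mobius a v) * mobius a w = (1 - Cconj v * w) * (1 - Cconj a * a) /
  ((1 + Cconj a * w) * (1 + a * Cconj v)))%C).
{ unfold mobius; rewrite Cdiv_conj by auto.
  rewrite !Cplus_conj, Cmult_conj, Cconj_conj, Cconj_RtoC.
  field; auto. }
rewrite h1, h2, !Cmod_div, !Cmod_mult, hmod by (apply Cmult_neq_0; auto).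
field; split; apply Rgt_not_eq, Cmod_gt_0; auto.
Qed.

Lemma Cdifferentiable_mobius (a w : C) : disk a -> disk w -> Cdifferentiable (mobius a) w.
Proof.
intros ha hw; apply Cdifferentiable_div; [apply mobius_den_neq0; auto; left; auto | |].
- apply (Cdifferentiable_plus (fun w => w)); [apply Cdifferentiable_id |].
  apply Cdifferentiable_const.
- apply (Cdifferentiable_plus (fun _ => RtoC 1)); [apply Cdifferentiable_const |].
  apply (Cdifferentiable_mult (fun _ => Cconj a)); [apply Cdifferentiable_const |].
  apply Cdifferentiable_id.
Qed.

Lemma holomorphic_on_disk_iff (f : C -> C) :
  holomorphic_on_disk f <-> forall z, disk z -> Cdifferentiable f z.
Proof.
split.
- intros h z hz; destruct (h z hz) as [l [hl1 hl2]]; exists l; split; [| exact hl2].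
  apply is_linear_scal_l.
- intros h z hz; destruct (h z hz) as [l [hl1 hl2]]; exists l; split; [| exact hl2].
  apply (@is_linear_scal_l C_AbsRing C_NormedModule).
Qed.

Lemma Cmod_unimodular_mul (c w : C) : Cmod c = 1 -> disk w -> disk (c * w)%C.
Proof. unfold disk; intros hc hw; rewrite Cmod_mult, hc; lra. Qed.

Lemma holomorphic_off_nil (f : C -> C) : holomorphic_on_disk f -> holomorphic_off nil f.
Proof.
intros hf z hz; assert (h := proj1 (holomorphic_on_disk_iff f) hf z hz).
split; auto; apply Cdifferentiable_continuous; auto.
Qed.

(** Equality case: the Schwarz-Pick inequality for [k] between [p], where [|k| = 1],
    and any other point forces [k] to be constant. The relation defining [k] then
    reads [f = mobius b o (c .) o mobius (- p)], which is invertible. *)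
Lemma disk_automorphism_of_schwarz_pick_eq (f k : C -> C) (p : C) :
  holomorphic_self_map f -> disk p ->
  holomorphic_off (p :: nil) k -> (forall z, disk z -> Cmod (k z) <= 1) ->
  (forall z, disk z -> ((f z - f p) * (1 - Cconj p * z) =
       k z * (z - p) * (1 - Cconj (f p) * f z))%C) ->
  Cmod (k p) = 1 -> disk_automorphism f.
Proof.
intros [hf1 hf2] hp hk hk1 hfk hkp; split; [split; auto |].
assert (hconst : forall z, disk z -> k z = k p).
{ intros z hz; destruct (excluded_middle_informative (z = p)) as [-> | hzp]; auto.
  assert (h := schwarz_pick (p :: nil) k p z hk hk1 hp hz
    ltac:(intros [h | []]; auto)).
  assert (h1 := pseudo_hyperbolic_identity (k p) (k z)); rewrite hkp in h1.
  assert (h2 := pseudo_hyperbolic_identity p z).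
  assert (h3 := Cmod_lt1_sqr p hp); assert (h4 := Cmod_lt1_sqr z hz).
  assert (h5 := Cmod_ge_0 (p - z)); assert (h6 := Cmod_ge_0 (1 - Cconj z * p)%C).
  assert (h7 := Cmod_ge_0 (k p - k z)); assert (h8 := Cmod_ge_0 (1 - Cconj (k z) * k p)%C).
  assert (e : Cmod (1 - Cconj (k z) * k p)%C = Cmod (k p - k z)).
  { apply Rle_antisym; apply sqr_le_of_le; auto; lra. }
  rewrite e in h.
  assert (hlt : Cmod (p - z) < Cmod (1 - Cconj z * p)%C).
  { assert (0 < (1 - Cmod p ^ 2) * (1 - Cmod z ^ 2)) by (apply Rmult_lt_0_compat; lra).
    apply Rnot_le_lt; intros hle; nra. }
  assert (h0 : Cmod (k p - k z) = 0) by nra.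
  apply Cmod_eq_0 in h0; replace (k z) with (k p - (k p - k z))%C by ring.
  rewrite h0; ring. }
set (c := k p) in *; set (b := f p) in *.
assert (hb : disk b) by (apply hf1; auto).
assert (hcc : (Cconj c * c = 1)%C).
{ rewrite Cmult_comm; apply unimodular_mul_conj; auto. }
assert (hc' : Cmod (Cconj c) = 1) by (rewrite Cmod_conj; auto).
assert (hpn := disk_opp p hp); assert (hbn := disk_opp b hb).
assert (hform : forall z, disk z -> f z = mobius b (c * mobius (- p) z)%C).
{ intros z hz; apply mobius_eq_of_quotient; auto.
  - apply Cmod_unimodular_mul; auto; apply mobius_disk; auto.
  - assert (hd := one_minus_conj_mul_neq0 z p (Rlt_le _ _ hz) hp).
    assert (h := hfk z hz); rewrite (hconst z hz) in h.
    replace (f z - b)%C with ((f z - b) * (1 - Cconj p * z) / (1 - Cconj p * z))%C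
      by (field; auto).
    rewrite h; unfold mobius; rewrite Copp_conj; field; repeat split; auto.
    intros h'; apply hd; rewrite <- h'; ring. }
exists (fun y => mobius p (Cconj c * mobius (- b) y)%C); split; [split |split].
- intros y hy; apply mobius_disk; auto; apply Cmod_unimodular_mul; auto.
  apply mobius_disk; auto.
- apply holomorphic_on_disk_iff; intros y hy.
  apply (Cdifferentiable_comp (mobius p) (fun y => Cconj c * mobius (- b) y)%C).
  + apply Cdifferentiable_mobius; auto; apply Cmod_unimodular_mul; auto.
    apply mobius_disk; auto.
  + apply (Cdifferentiable_mult (fun _ => Cconj c)); [apply Cdifferentiable_const |].
    apply Cdifferentiable_mobius; auto.
- intros z hz; rewrite hform by auto.
  rewrite mobius_cancel; auto; [| apply Cmod_unimodular_mul; auto; apply mobius_disk; auto].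
  rewrite Cmult_assoc, hcc, Cmult_1_l; apply mobius_cancel'; auto.
- intros y hy; rewrite hform.
  + rewrite mobius_cancel; auto;
      [| apply Cmod_unimodular_mul; auto; apply mobius_disk; auto].
    rewrite Cmult_assoc, (Cmult_comm c), hcc, Cmult_1_l; apply mobius_cancel'; auto.
  + apply mobius_disk; auto; apply Cmod_unimodular_mul; auto; apply mobius_disk; auto.
Qed.

(** * Absence of maxima of the density along geodesics *)

Definition density (f : C -> C) (z : C) : R := (1 - Cmod (f z) ^ 2) / (1 - Cmod z ^ 2).

Lemma Cmod_one_plus_sqr (t : R) (y : C) :
  Cmod (1 + t * y)%C ^ 2 = 1 + 2 * t * Re y + t ^ 2 * Cmod y ^ 2.
Proof. rewrite !Cmod2_alt; destruct y; simpl; ring. Qed.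

(** Adding the two hypotheses cancels the terms of odd order in [t], except those that
    involve the difference [u - v], which is itself of order [t]. What remains is of
    order [t^2]; the conclusion is that remainder divided by [t^2], the higher
    order terms being absorbed in [4 t]. *)
Lemma symmetric_second_difference (t : R) (b P u v : C) :
  0 < t < 1 -> Cmod b <= 1 -> Cmod P <= 1 -> Cmod u <= 1 -> Cmod v <= 1 ->
  Cmod (u - v) <= 2 * t * Cmod (1 - Cconj v * u)%C ->
  (1 - t ^ 2 * Cmod u ^ 2) * Cmod (1 + t * P)%C ^ 2 <=
    (1 - t ^ 2) * Cmod (1 + t * (Cconj b * u))%C ^ 2 ->
  (1 - t ^ 2 * Cmod v ^ 2) * Cmod (1 + (- t)%R * P)%C ^ 2 <=
    (1 - t ^ 2) * Cmod (1 + (- t)%R * (Cconj b * v))%C ^ 2 ->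
  0 <= 4 * Cmod b * Cmod (1 - Cconj v * u)%C +
    (Cmod u ^ 2 + Cmod v ^ 2) * (1 + Cmod b ^ 2) - 2 - 2 * Cmod P ^ 2 + 4 * t.
Proof.
intros ht hb hP hu hv huv h1 h2.
rewrite !Cmod_one_plus_sqr in h1, h2; rewrite !Cmod_mult, !Cmod_conj in h1, h2.
assert (hre : Re (Cconj b * u)%C - Re (Cconj b * v)%C <=
  2 * t * (Cmod b * Cmod (1 - Cconj v * u)%C)).
{ replace (Re (Cconj b * u)%C - Re (Cconj b * v)%C) with (Re (Cconj b * (u - v))%C)
    by (destruct b, u, v; simpl; ring).
  eapply Rle_trans; [apply Rle_abs |]; eapply Rle_trans; [apply re_le_Cmod |].
  rewrite Cmod_mult, Cmod_conj.
  replace (2 * t * (Cmod b * Cmod (1 - Cconj v * u)%C)) with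
    (Cmod b * (2 * t * Cmod (1 - Cconj v * u)%C)) by ring.
  apply Rmult_le_compat_l; [apply Cmod_ge_0 | auto]. }
assert (hPr : Rabs (Re P) <= 1) by (eapply Rle_trans; [apply re_le_Cmod | auto]).
apply Rabs_le_between in hPr.
assert (hu2 := Cmod_le1_sqr u hu); assert (hv2 := Cmod_le1_sqr v hv).
assert (hP2 := Cmod_le1_sqr P hP); assert (hb2 := Cmod_le1_sqr b hb).
assert (hu3 := pow2_ge_0 (Cmod u)); assert (hv3 := pow2_ge_0 (Cmod v)).
assert (hP3 := pow2_ge_0 (Cmod P)); assert (hb3 := pow2_ge_0 (Cmod b)).
rewrite !Rpow_mult_distr in h1, h2.
assert (hW : 0 <= Cmod b * Cmod (1 - Cconj v * u)%C)
  by (apply Rmult_le_pos; apply Cmod_ge_0).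
replace (4 * Cmod b * Cmod (1 - Cconj v * u)%C) with
  (4 * (Cmod b * Cmod (1 - Cconj v * u)%C)) by ring.
set (W := Cmod b * Cmod (1 - Cconj v * u)%C) in *.
set (x := Re (Cconj b * u)%C) in *; set (y := Re (Cconj b * v)%C) in *.
set (p := Re P) in *.
set (U := Cmod u ^ 2) in *; set (V := Cmod v ^ 2) in *.
set (B := Cmod b ^ 2) in *; set (Q := Cmod P ^ 2) in *.
clearbody W x y p U V B Q.
assert (ht2 : 0 < t ^ 2 < 1) by nra.
assert (h3 : 0 <= 2 * t * (1 - t ^ 2) * (x - y) + t ^ 2 * ((U + V) * (1 + B) - 2 - 2 * Q)
  + 2 * t ^ 3 * (p * (U - V)) + t ^ 4 * ((U + V) * (Q - B))) by lra.
assert (h4 : (1 - t ^ 2) * (x - y) <= 2 * t * W).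
{ apply Rle_trans with ((1 - t ^ 2) * (2 * t * W)); [apply Rmult_le_compat_l; lra |].
  assert (0 <= 2 * t * W) by (apply Rmult_le_pos; lra); nra. }
assert (h5 : p * (U - V) <= 1) by nra.
assert (h6 : (U + V) * (Q - B) <= 2) by nra.
assert (h7 : 0 <= t ^ 2 * (4 * W + ((U + V) * (1 + B) - 2 - 2 * Q) + 2 * t + 2 * t ^ 2)).
{ assert (0 <= t ^ 3) by (apply pow_le; lra).
  assert (0 <= t ^ 4) by (apply pow_le; lra).
  assert (t ^ 3 * (p * (U - V)) <= t ^ 3 * 1) by (apply Rmult_le_compat_l; auto).
  assert (t ^ 4 * ((U + V) * (Q - B)) <= t ^ 4 * 2) by (apply Rmult_le_compat_l; auto).
  assert (t * ((1 - t ^ 2) * (x - y)) <= t * (2 * t * W)) by (apply Rmult_le_compat_l; lra).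
  lra. }
apply Rmult_le_reg_l with (t ^ 2); [lra |].
assert (t ^ 2 <= t) by nra; nra.
Qed.

Lemma real_mul_disk (t : R) (eta : C) : Cmod eta = 1 -> Rabs t < 1 -> disk (t * eta)%C.
Proof. intros he ht; unfold disk; rewrite Cmod_mult, Cmod_R, he; lra. Qed.

(** No local maximum along a geodesic. In the coordinate [t] on the geodesic through
    [p], Schwarz-Pick gives [f = mobius b (t kap)] with [|kap| <= 1]; the factors
    [1 - |b|^2] and [1 - |p|^2] drop out of the comparison of the densities at [t]
    and [0]. [symmetric_second_difference] applies because [kap t - kap (- t)] is
    controlled by Schwarz-Pick for the quotient [k]. In the limit the right-hand
    side is [- 2 e] with
    [e = (1 - |kap 0|^2) (1 - |b|)^2 + |p|^2 - |b|^2], which is positive: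
    [1 <= density f p] means [|b| <= |p|], strictly so for automorphisms, and
    [|kap 0| = 1] only happens for automorphisms. *)
Lemma density_exceeded_on_geodesic (f : C -> C) (p eta : C) (d : R) :
  holomorphic_self_map f -> disk p -> Cmod eta = 1 ->
  1 <= density f p -> (disk_automorphism f -> 1 < density f p) ->
  0 < d -> exists t, Rabs t < d /\ Rabs t < 1 /\
    density f p < density f (mobius p (t * eta)%C).
Proof.
intros hf hp he hdens haut hd; apply NNPP; intros hno.
assert (hle : forall t, Rabs t < d -> Rabs t < 1 ->
  density f (mobius p (t * eta)%C) <= density f p).
{ intros t h1 h2; apply Rnot_lt_le; intros h; apply hno; exists t; auto. }
clear hno; destruct hf as [hf1 hf2].
destruct (schwarz_pick_quotient nil f p (holomorphic_off_nil f hf2) hf1 hp (fun h => h))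
  as (k & hk & hk1 & hfk).
set (b := f p) in *; assert (hb : disk b) by (apply hf1; auto).
assert (hp2 := Cmod_lt1_sqr p hp); assert (hb2 := Cmod_lt1_sqr b hb).
assert (hpt : forall t, Rabs t < 1 -> disk (mobius p (t * eta)%C)).
{ intros t ht; apply mobius_disk; auto; apply real_mul_disk; auto. }
set (kap := fun t : R => (eta * k (mobius p (t * eta)))%C).
assert (hkap1 : forall t, Rabs t < 1 -> Cmod (kap t) <= 1).
{ intros t ht; unfold kap; rewrite Cmod_mult, he, Rmult_1_l; apply hk1; auto. }
assert (hft : forall t, Rabs t < 1 -> f (mobius p (t * eta)%C) = mobius b (t * kap t)%C).
{ intros t ht; apply mobius_eq_of_quotient; auto.
  - unfold disk; rewrite Cmod_mult, Cmod_R.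
    generalize (hkap1 t ht) (Cmod_ge_0 (kap t)) (Rabs_pos t); nra.
  - set (z := mobius p (t * eta)%C).
    assert (hz : disk z) by (apply hpt; auto).
    assert (hn := one_minus_conj_mul_neq0 z p (Rlt_le _ _ hz) hp).
    assert (h := hfk z hz); unfold z at 4 in h.
    rewrite mobius_sub_center in h by (auto; apply real_mul_disk; auto); fold z in h.
    replace (f z - b)%C with ((f z - b) * (1 - Cconj p * z) / (1 - Cconj p * z))%C
      by (field; auto).
    rewrite h; unfold kap; fold z; field; auto. }
assert (hineq : forall t, Rabs t < d -> Rabs t < 1 ->
  (1 - t ^ 2 * Cmod (kap t) ^ 2) * Cmod (1 + t * (Cconj p * eta))%C ^ 2 <=
  (1 - t ^ 2) * Cmod (1 + t * (Cconj b * kap t))%C ^ 2).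
{ intros t ht1 ht2.
  assert (hz := real_mul_disk t eta he ht2).
  assert (hw : disk (t * kap t)%C).
  { unfold disk; rewrite Cmod_mult, Cmod_R.
    generalize (hkap1 t ht2) (Cmod_ge_0 (kap t)) (Rabs_pos t); nra. }
  assert (h := hle t ht1 ht2); unfold density in h; rewrite (hft t ht2) in h.
  rewrite !mobius_defect in h by auto; fold b in h.
  assert (n1 := proj1 (Cmod_gt_0 _) (mobius_den_neq0 _ _ hp (Rlt_le _ _ hz))).
  assert (n2 := proj1 (Cmod_gt_0 _) (mobius_den_neq0 _ _ hb (Rlt_le _ _ hw))).
  replace (Cconj p * (t * eta))%C with (t * (Cconj p * eta))%C in * by ring.
  replace (Cconj b * (t * kap t))%C with (t * (Cconj b * kap t))%C in * by ring.
  set (X := Cmod (1 + t * (Cconj p * eta))%C) in *.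
  set (Y := Cmod (1 + t * (Cconj b * kap t))%C) in *.
  assert (hz2 := Cmod_lt1_sqr _ hz); assert (hw2 := Cmod_lt1_sqr _ hw).
  rewrite !Cmod_mult, !Cmod_R, !Rpow_mult_distr, !pow2_abs in h.
  rewrite Cmod_mult, Cmod_R, Rpow_mult_distr, pow2_abs in hz2.
  rewrite he in h, hz2; replace (t ^ 2 * 1 ^ 2) with (t ^ 2) in h, hz2 by ring.
  set (T := t ^ 2 * Cmod (kap t) ^ 2) in *.
  assert (hX : 0 < X ^ 2) by (apply pow_lt; auto).
  assert (hY : 0 < Y ^ 2) by (apply pow_lt; auto).
  apply Rmult_le_reg_l with ((1 - Cmod b ^ 2) / (1 - Cmod p ^ 2) / ((1 - t ^ 2) * Y ^ 2)).
  { repeat apply Rdiv_lt_0_compat; try lra; apply Rmult_lt_0_compat; lra. }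
  match goal with |- ?a <= ?c =>
    match type of h with ?a' <= ?c' => replace a with a'; [replace c with c' |] end end.
  - exact h.
  - field; lra.
  - field; repeat split; lra. }
set (k0 := kap 0).
assert (hkc : forall eps, 0 < eps -> exists r, 0 < r /\
  forall t, Rabs t < r -> Rabs t < 1 -> Cmod (kap t - k0) < eps).
{ intros eps heps.
  assert (hk0 : k0 = (eta * k p)%C).
  { unfold k0, kap; rewrite Cmult_0_l, mobius_0; auto. }
  destruct (proj1 (Ccontinuous_eps k p) (proj1 (hk p hp)) eps heps) as (r1 & hr1 & hw1).
  assert (hm := Cdifferentiable_continuous _ _ (Cdifferentiable_mobius p 0 hp
    ltac:(unfold disk; rewrite Cmod_0; lra))).
  destruct (proj1 (Ccontinuous_eps (mobius p) 0) hm r1 hr1) as (r2 & hr2 & hw2).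
  exists r2; split; auto; intros t ht1 ht2; rewrite hk0; unfold kap.
  replace (eta * k (mobius p (t * eta)) - eta * k p)%C with
    (eta * (k (mobius p (t * eta)) - k p))%C by ring.
  rewrite Cmod_mult, he, Rmult_1_l; apply hw1.
  rewrite <- (mobius_0 p) at 2; apply hw2.
  replace (t * eta - 0)%C with (t * eta)%C by ring.
  rewrite Cmod_mult, Cmod_R, he; lra. }
assert (hk01 : Cmod k0 <= 1) by (apply hkap1; rewrite Rabs_R0; lra).
assert (hk0k : Cmod k0 = Cmod (k p)).
{ unfold k0, kap; rewrite Cmult_0_l, mobius_0, Cmod_mult, he; ring. }
assert (hm := Cmod_le1_sqr k0 hk01); assert (hm0 := pow2_ge_0 (Cmod k0)).
assert (hbp : Cmod b ^ 2 <= Cmod p ^ 2).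
{ unfold density in hdens; fold b in hdens.
  apply (Rmult_le_compat_r (1 - Cmod p ^ 2)) in hdens; [| lra].
  unfold Rdiv in hdens; rewrite Rmult_assoc, Rinv_l, Rmult_1_r in hdens; lra. }
assert (hb0 := Cmod_ge_0 b); unfold disk in hb, hp.
set (e := (1 - Cmod k0 ^ 2) * (1 - Cmod b) ^ 2 + (Cmod p ^ 2 - Cmod b ^ 2)).
(* the first term is positive when [|kap 0| < 1], and otherwise [f] is an
   automorphism and the second one is *)
assert (hE : 0 < e).
{ assert (h1 : 0 <= (1 - Cmod k0 ^ 2) * (1 - Cmod b) ^ 2)
    by (apply Rmult_le_pos; [lra | apply pow2_ge_0]).
  unfold e; destruct (Rlt_dec (Cmod k0) 1) as [hlt | hge].
  - assert (0 < (1 - Cmod k0 ^ 2) * (1 - Cmod b) ^ 2).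
    { apply Rmult_lt_0_compat; [| apply pow_lt; lra].
      generalize (Cmod_lt1_sqr k0 hlt); lra. }
    lra.
  - assert (h2 : disk_automorphism f).
    { apply (disk_automorphism_of_schwarz_pick_eq f k p); auto; [split; auto | lra]. }
    apply haut in h2; unfold density in h2; fold b in h2.
    apply (Rmult_lt_compat_r (1 - Cmod p ^ 2)) in h2; [| lra].
    unfold Rdiv in h2; rewrite Rmult_assoc, Rinv_l, Rmult_1_r in h2; lra. }
assert (he16 : 0 < e / 16) by lra.
destruct (hkc _ he16) as (r & hr & hkr).
(* [u] and [v] are within [e / 16] of [kap 0], which costs at most [e] in the limit
   inequality, and [4 t <= e / 2]: less than the [2 e] available *)
set (t := Rmin (1 / 2) (Rmin (d / 2) (Rmin (r / 2) (e / 8)))).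
assert (ht : 0 < t) by (unfold t; repeat apply Rmin_case; lra).
assert (ht1 : t <= 1 / 2) by apply Rmin_l.
assert (ht2 : t <= d / 2 /\ t <= r / 2 /\ t <= e / 8).
{ assert (h1 := Rmin_r (1 / 2) (Rmin (d / 2) (Rmin (r / 2) (e / 8)))); fold t in h1.
  assert (h2 := Rmin_r (d / 2) (Rmin (r / 2) (e / 8))).
  generalize (Rmin_l (d / 2) (Rmin (r / 2) (e / 8))) (Rmin_l (r / 2) (e / 8))
    (Rmin_r (r / 2) (e / 8)); lra. }
destruct ht2 as (ht2 & ht3 & ht4).
assert (at1 : Rabs t = t) by (apply Rabs_pos_eq; lra).
assert (at2 : Rabs (- t) = t) by (rewrite Rabs_Ropp; auto).
assert (bt1 : Rabs t < 1) by lra; assert (bt2 : Rabs (- t) < 1) by lra.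
set (u := kap t); set (v := kap (- t)).
assert (hu : Cmod (u - k0) < e / 16) by (apply hkr; lra).
assert (hv : Cmod (v - k0) < e / 16) by (apply hkr; lra).
assert (hu1 : Cmod u <= 1) by (apply hkap1; auto).
assert (hv1 : Cmod v <= 1) by (apply hkap1; auto).
assert (huv : Cmod (u - v) <= 2 * t * Cmod (1 - Cconj v * u)%C).
{ assert (z1 := real_mul_disk t eta he bt1); assert (z2 := real_mul_disk (- t) eta he bt2).
  assert (hne : mobius p ((- t)%R * eta)%C <> p).
  { intros h; assert (h' := mobius_sub_center p ((- t)%R * eta) hp z2); rewrite h in h'.
    replace (p - p)%C with (RtoC 0) in h' by ring; symmetry in h'.
    apply (f_equal Cmod) in h'; rewrite !Cmod_mult, Cmod_R, he, Cmod_0, at2 in h'.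
    assert (h3 := proj1 (Cmod_gt_0 _) (one_minus_sqr_neq0 p hp)); nra. }
  assert (hsp := schwarz_pick (p :: nil) k (mobius p (t * eta)%C)
    (mobius p ((- t)%R * eta)%C) hk hk1 (hpt t bt1) (hpt (- t) bt2)
    ltac:(intros [h | []]; auto)).
  assert (hiso := mobius_isometry p ((- t)%R * eta) (t * eta) hp z2 z1).
  set (zp := mobius p (t * eta)%C) in *; set (zm := mobius p ((- t)%R * eta)%C) in *.
  replace (t * eta - (- t)%R * eta)%C with (RtoC (2 * t) * eta)%C in hiso
    by (rewrite RtoC_mult, RtoC_opp; ring).
  rewrite Cmult_conj in hiso.
  replace (1 - Cconj (- t)%R * Cconj eta * (t * eta))%C with (RtoC (1 + t ^ 2)) in hiso.
  2:{ rewrite Cconj_RtoC; replace (1 - (- t)%R * Cconj eta * (t * eta))%C with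
        (1 + t ^ 2 * (eta * Cconj eta))%C by (rewrite RtoC_opp; ring).
      rewrite unimodular_mul_conj, RtoC_plus, RtoC_pow by auto; ring. }
  rewrite Cmod_mult, he, !Cmod_R, Rmult_1_r, !Rabs_pos_eq in hiso by nra.
  replace (u - v)%C with (eta * (k zp - k zm))%C by (unfold u, v, kap; fold zp zm; ring).
  replace (Cconj v * u)%C with (Cconj (k zm) * k zp)%C.
  2:{ unfold u, v, kap; fold zp zm; rewrite Cmult_conj.
      replace (Cconj eta * Cconj (k zm) * (eta * k zp))%C with
        (eta * Cconj eta * (Cconj (k zm) * k zp))%C by ring.
      rewrite unimodular_mul_conj by auto; ring. }
  rewrite Cmod_mult, he, Rmult_1_l.
  assert (hn := one_minus_conj_mul_neq0 zp zm (Rlt_le _ _ (hpt t bt1)) (hpt (- t) bt2)).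
  apply Cmod_gt_0 in hn.
  set (N := Cmod (1 - Cconj zm * zp)%C) in *.
  set (Z := Cmod (zp - zm)) in *; set (A := Cmod (k zp - k zm)) in *.
  set (D := Cmod (1 - Cconj (k zm) * k zp)%C) in *.
  assert (hD : 0 <= D) by apply Cmod_ge_0; assert (hZ : 0 <= Z) by apply Cmod_ge_0.
  assert (hZN : Z <= 2 * t * N) by nra.
  apply Rmult_le_reg_r with N; auto.
  apply Rle_trans with (1 := hsp).
  replace (2 * t * D * N) with (2 * t * N * D) by ring.
  apply Rmult_le_compat_r; auto. }
assert (hP : Cmod (Cconj p * eta)%C = Cmod p)
  by (rewrite Cmod_mult, Cmod_conj, he; ring).
assert (hv3 := hineq (- t) ltac:(lra) bt2).
replace ((- t) ^ 2) with (t ^ 2) in hv3 by ring.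
assert (hfin := symmetric_second_difference t b (Cconj p * eta) u v ltac:(lra)
  ltac:(lra) ltac:(lra) hu1 hv1 huv (hineq t ltac:(lra) bt1) hv3).
rewrite hP in hfin.
assert (hsq : forall w, Cmod w <= 1 -> Cmod (w - k0) < e / 16 ->
  Cmod w ^ 2 <= Cmod k0 ^ 2 + e / 8).
{ intros w h1 h2; generalize (Cmod_triangle_sub w k0) (Cmod_ge_0 w) (Cmod_ge_0 k0); nra. }
assert (hu4 := hsq u hu1 hu); assert (hv4 := hsq v hv1 hv).
assert (hcross : Cmod (1 - Cconj v * u)%C <= 1 - Cmod k0 ^ 2 + e / 8).
{ replace (1 - Cconj v * u)%C with
    (RtoC (1 - Cmod k0 ^ 2) + (- Cconj v * (u - k0) + - Cconj (v - k0) * k0))%C.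
  - eapply Rle_trans; [apply Cmod_triangle |].
    rewrite Cmod_R, Rabs_pos_eq by lra.
    assert (h1 := Cmod_triangle (- Cconj v * (u - k0))%C (- Cconj (v - k0) * k0)%C).
    rewrite !Cmod_mult, !Cmod_opp, !Cmod_conj in h1.
    generalize (Cmod_ge_0 v) (Cmod_ge_0 (u - k0)) (Cmod_ge_0 (v - k0)) (Cmod_ge_0 k0).
    intros; assert (Cmod v * Cmod (u - k0) <= 1 * (e / 16))
      by (apply Rmult_le_compat; lra).
    assert (Cmod (v - k0) * Cmod k0 <= (e / 16) * 1) by (apply Rmult_le_compat; lra).
    lra.
  - rewrite RtoC_minus, Cmod2_conj, Cminus_conj; ring. }
assert (hlast : 4 * Cmod b * Cmod (1 - Cconj v * u)%C <=
  4 * Cmod b * (1 - Cmod k0 ^ 2 + e / 8)) by (apply Rmult_le_compat_l; lra).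
assert (hlast2 : (Cmod u ^ 2 + Cmod v ^ 2) * (1 + Cmod b ^ 2) <=
  (2 * Cmod k0 ^ 2 + e / 4) * (1 + Cmod b ^ 2)) by (apply Rmult_le_compat_r; nra).
assert (h1 : 4 * Cmod b * (e / 8) <= e / 2) by nra.
assert (h2 : e / 4 * (1 + Cmod b ^ 2) <= e / 2) by nra.
assert (h3 : 4 * Cmod b * (1 - Cmod k0 ^ 2) + 2 * Cmod k0 ^ 2 * (1 + Cmod b ^ 2)
  - 2 - 2 * Cmod p ^ 2 = - 2 * e) by (unfold e; ring).
clearbody e; nra.
Qed.

(** The geodesic [t |-> mobius a (t eta)] can be recentred at any of its points; its
    parameter changes by the real automorphism [t |-> (t + s) / (1 + s t)]. *)
Lemma mobius_move_base (a eta : C) (s : R) :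
  disk a -> Cmod eta = 1 -> Rabs s < 1 ->
  exists eta', Cmod eta' = 1 /\ forall t, Rabs t < 1 ->
    mobius a (((t + s) / (1 + s * t))%R * eta)%C =
    mobius (mobius a (s * eta)%C) (t * eta')%C.
Proof.
intros ha he hs.
assert (hsd := real_mul_disk s eta he hs).
assert (hd := mobius_den_neq0 a (s * eta) ha (Rlt_le _ _ hsd)).
assert (hee := unimodular_mul_conj eta he).
assert (hcd : Cconj (1 + Cconj a * (s * eta))%C = (1 + a * (s * Cconj eta))%C).
{ rewrite Cplus_conj, !Cmult_conj, Cconj_conj, !Cconj_RtoC; reflexivity. }
assert (hd' : (1 + a * (s * Cconj eta))%C <> RtoC 0).
{ rewrite <- hcd; apply Cmod_gt_0; rewrite Cmod_conj; apply Cmod_gt_0; auto. }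
(* this is [(eta + a s) / (1 + conj a s eta)], in a form whose modulus is visibly 1 *)
exists (eta * Cconj (1 + Cconj a * (s * eta)) / (1 + Cconj a * (s * eta)))%C; split.
{ rewrite Cmod_div, Cmod_mult, Cmod_conj, he by auto.
  field; apply Rgt_not_eq, Cmod_gt_0; auto. }
intros t ht; rewrite hcd.
assert (hst : 0 < 1 + s * t).
{ apply Rabs_def2 in hs; apply Rabs_def2 in ht; nra. }
assert (hstC : (1 + s * t)%C <> RtoC 0).
{ rewrite <- RtoC_mult, <- RtoC_plus; intros h; apply RtoC_inj in h; lra. }
assert (hM : Rabs ((t + s) / (1 + s * t)) < 1).
{ apply Rabs_def2 in hs; apply Rabs_def2 in ht; apply Rabs_def1.
  - apply Rlt_div_l; nra.
  - apply Rlt_div_r; nra. }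
assert (hMd := real_mul_disk _ eta he hM).
assert (hn := mobius_den_neq0 a _ ha (Rlt_le _ _ hMd)).
rewrite RtoC_div, !RtoC_plus, RtoC_mult in * by lra.
assert (hpc : (Cconj (mobius a (s * eta)) *
  (t * (eta * (1 + a * (s * Cconj eta)) / (1 + Cconj a * (s * eta)))) =
  t * (s + Cconj a * eta) / (1 + Cconj a * (s * eta)))%C).
{ unfold mobius; rewrite Cdiv_conj, hcd, Cplus_conj, Cmult_conj, Cconj_RtoC by auto.
  replace (s + Cconj a * eta)%C with (s * (eta * Cconj eta) + Cconj a * eta)%C
    by (rewrite hee; ring).
  field; auto. }
assert (hnum : (t * (eta * (1 + a * (s * Cconj eta)) / (1 + Cconj a * (s * eta))) +
  mobius a (s * eta) = (t * (eta + a * s) + s * eta + a) / (1 + Cconj a * (s * eta)))%C).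
{ replace (eta + a * s)%C with (eta + a * s * (eta * Cconj eta))%C by (rewrite hee; ring).
  unfold mobius; field; auto. }
assert (hden : (1 + Cconj a * (s * eta) + t * (s + Cconj a * eta))%C <> RtoC 0).
{ intros h; apply hn.
  replace (1 + Cconj a * ((t + s) / (1 + s * t) * eta))%C with
    ((1 + Cconj a * (s * eta) + t * (s + Cconj a * eta)) / (1 + s * t))%C
    by (field; auto).
  rewrite h; field; auto. }
assert (hrhs : mobius (mobius a (s * eta))
   (t * (eta * (1 + a * (s * Cconj eta)) / (1 + Cconj a * (s * eta)))) =
  ((t * (eta + a * s) + s * eta + a) /
   (1 + Cconj a * (s * eta) + t * (s + Cconj a * eta)))%C).
{ unfold mobius at 1; rewrite hpc, hnum; field; auto. }
rewrite hrhs; unfold mobius; field; repeat split; auto.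
Qed.

Lemma continuous_Cmod (g : C -> C) (z : C) :
  Ccontinuous g z -> @continuous C_metric R_UniformSpace (fun w => Cmod (g w)) z.
Proof.
intros hg; apply (@continuous_comp C_metric C_metric R_UniformSpace g Cmod); auto.
exact (@filterlim_norm C_AbsRing C_normed (g z)).
Qed.

Lemma continuous_density (f : C -> C) (z : C) : holomorphic_self_map f -> disk z ->
  @continuous C_metric R_UniformSpace (density f) z.
Proof.
intros [hf1 hf2] hz; assert (hfz := proj1 (holomorphic_on_disk_iff f) hf2 z hz).
assert (hsq : forall g : C -> C, Ccontinuous g z ->
  @continuous C_metric R_UniformSpace (fun w => 1 - Cmod (g w) ^ 2) z).
{ intros g hg; apply (@continuous_comp C_metric R_UniformSpace R_UniformSpace
    (fun w => Cmod (g w)) (fun x => 1 - x ^ 2)); [apply continuous_Cmod; auto |].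
  apply continuity_pt_filterlim, derivable_continuous_pt.
  apply derivable_pt_minus; [apply derivable_pt_const | apply derivable_pt_pow]. }
apply (@continuous_mult C_metric R_AbsRing (fun w => 1 - Cmod (f w) ^ 2)
  (fun w => / (1 - Cmod w ^ 2))).
- apply hsq, Cdifferentiable_continuous; auto.
- apply (@continuous_comp C_metric R_UniformSpace R_UniformSpace
    (fun w => 1 - Cmod w ^ 2) Rinv).
  + apply (hsq (fun w => w)), Cdifferentiable_continuous, Cdifferentiable_id.
  + apply continuity_pt_filterlim.
    apply (continuity_pt_inv (fun x => x)); [apply continuity_pt_id |].
    generalize (Cmod_lt1_sqr z hz); lra.
Qed.

Lemma continuity_pt_density_geodesic (f : C -> C) (a eta : C) (t : R) :
  holomorphic_self_map f -> disk a -> Cmod eta = 1 -> Rabs t < 1 ->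
  continuity_pt (fun s => density f (mobius a (s * eta)%C)) t.
Proof.
intros hf ha he ht; assert (hz := real_mul_disk t eta he ht).
apply continuity_pt_filterlim.
apply (@continuous_comp R_UniformSpace C_metric R_UniformSpace
  (fun s => mobius a (s * eta)%C) (density f));
  [| apply continuous_density; auto; apply mobius_disk; auto].
apply (@continuous_comp R_UniformSpace C_metric C_metric
  (fun s => (s * eta)%C) (mobius a));
  [| apply Cdifferentiable_continuous, Cdifferentiable_mobius; auto].
intros P hP; apply locally_metric in hP; destruct hP as (d & hd & hw).
exists (mkposreal d hd); intros s hs; change (Rabs (s - t) < d) in hs; apply hw.
replace (s * eta - t * eta)%C with (RtoC (s - t) * eta)%C by (rewrite RtoC_minus; ring).
rewrite Cmod_mult, Cmod_R, he; lra.
Qed.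

(** If the level [lambda] were reached inside, the density would have a maximum on the
    arc, of value at least [lambda >= 1], at an interior parameter [m]. Recentre the
    geodesic there. *)
Lemma density_lt_between (lambda : R) (f : C -> C) (a eta : C) (t1 t t2 : R) :
  1 <= lambda -> holomorphic_self_map f -> (lambda = 1 -> ~ disk_automorphism f) ->
  disk a -> Cmod eta = 1 -> -1 < t1 -> t1 < t -> t < t2 -> t2 < 1 ->
  density f (mobius a (t1 * eta)%C) <= lambda ->
  density f (mobius a (t2 * eta)%C) <= lambda ->
  density f (mobius a (t * eta)%C) < lambda.
Proof.
intros hl hf haut ha he h1 h2 h3 h4 hd1 hd2; apply Rnot_le_lt; intros hge.
set (v := fun s : R => density f (mobius a (s * eta)%C)).
assert (hmax : exists m, t1 < m < t2 /\ lambda <= v m /\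
  forall s, t1 <= s <= t2 -> v s <= v m).
{ destruct (continuity_ab_maj v t1 t2) as (m & hm & hmi); [lra | |].
  { intros c hc; apply continuity_pt_density_geodesic; auto; apply Rabs_def1; lra. }
  assert (hmt := hm t ltac:(lra)); fold (v t) in hge.
  destruct (Req_dec m t1) as [-> | n1]; [| destruct (Req_dec m t2) as [-> | n2]].
  - exists t; split; [lra | split; [auto |]].
    intros s hs; specialize (hm s hs); unfold v in *; lra.
  - exists t; split; [lra | split; [auto |]].
    intros s hs; specialize (hm s hs); unfold v in *; lra.
  - exists m; split; [lra | split; [unfold v in *; lra | auto]]. }
destruct hmax as (m & hm & hlm & hmax).
assert (hm1 : Rabs m < 1) by (apply Rabs_def1; lra).
destruct (mobius_move_base a eta m ha he hm1) as (eta' & he' & hmove).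
set (d := Rmin (m - t1) (t2 - m) / 2).
assert (hd : 0 < d) by (unfold d; apply Rdiv_lt_0_compat; [apply Rmin_case |]; lra).
assert (hda : 2 * d <= m - t1) by (unfold d; generalize (Rmin_l (m - t1) (t2 - m)); lra).
assert (hdb : 2 * d <= t2 - m) by (unfold d; generalize (Rmin_r (m - t1) (t2 - m)); lra).
assert (hp := mobius_disk a _ ha (real_mul_disk m eta he hm1)).
unfold v in hlm.
destruct (density_exceeded_on_geodesic f (mobius a (m * eta)%C) eta' d)
  as (s & hs1 & hs2 & hgt); auto; try lra.
{ intros hA; destruct (Req_dec lambda 1) as [e | n]; [exfalso; apply haut; auto | lra]. }
rewrite <- hmove in hgt by auto.
assert (hs3 := Rabs_def2 _ _ hs1); assert (hs4 := Rabs_def2 _ _ hs2).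
apply Rabs_def2 in hm1.
assert (hpos : 0 < 1 + m * s) by nra.
(* so that parameters [|s| < d] from [m] stay between [t1] and [t2] *)
assert (hdist : Rabs ((s + m) / (1 + m * s) - m) <= 2 * Rabs s).
{ replace ((s + m) / (1 + m * s) - m) with (s * ((1 - m ^ 2) / (1 + m * s)))
    by (field; lra).
  rewrite Rabs_mult, Rmult_comm; apply Rmult_le_compat_r; [apply Rabs_pos |].
  rewrite Rabs_pos_eq by (apply Rdiv_le_0_compat; nra).
  apply Rle_div_l; [auto |].
  assert (0 <= (1 + m) * (1 + s) /\ 0 <= (1 - m) * (1 - s)) by (split; nra).
  assert (0 <= (1 + m) * (1 - s) /\ 0 <= (1 - m) * (1 + s)) by (split; nra).
  destruct (Rle_dec 0 m); nra. }
apply Rabs_le_between in hdist.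
specialize (hmax ((s + m) / (1 + m * s)) ltac:(lra)); unfold v in hmax; lra.
Qed.

(** * Hyperbolic geodesics and segments *)

(** Diameters and orthogonal arcs satisfy one equation: orthogonality to the unit
    circle means [|c|^2 = 1 + r^2], which turns [|z - c| = r] into
    [1 + |z|^2 = 2 Re (conj c z)], and diameters are the case [alpha = 0]. *)
Lemma geodesic_equation (G : C -> Prop) : hyperbolic_geodesic G ->
  exists (alpha : R) (beta : C), alpha ^ 2 < Cmod beta ^ 2 /\
    forall z, G z -> disk z /\ alpha * (1 + Cmod z ^ 2) = 2 * Re (Cconj beta * z)%C.
Proof.
intros [(u & hu & hG) | (c & r & hr & [(p & hp1 & hp2) horth] & hG)].
- exists 0, (Ci * u)%C; split.
  + rewrite Cmod_mult, Cmod_Ci, hu; lra.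
  + intros z hz; apply hG in hz; destruct hz as [hz (t & ->)]; split; auto.
    destruct u; simpl; ring.
- exists 1, c.
  assert (hc : Cmod c ^ 2 = 1 + r ^ 2).
  { assert (h := horth p hp1 hp2); unfold circle in hp1, hp2.
    assert (h1 := f_equal (fun x => x ^ 2) hp1); assert (h2 := f_equal (fun x => x ^ 2) hp2).
    cbv beta in h1, h2; rewrite Cmod2_alt in h1, h2; rewrite Cmod2_alt.
    destruct p, c; simpl in *; lra. }
  split; [nra |].
  intros z hz; apply hG in hz; destruct hz as [hz hzc]; split; auto.
  assert (h1 := f_equal (fun x => x ^ 2) hzc); cbv beta in h1.
  rewrite Cmod2_alt in h1, hc; rewrite Cmod2_alt; destruct z, c; simpl in *; lra.
Qed.

(** Substituting [z = mobius a w] in the equation of [G], the terms of degree 0 and 2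
    in [w] cancel because [a] lies on [G]. What remains is [Re (conj nu w) = 0], a line
    through [0]. The discriminant [|beta|^2 - alpha^2] is multiplied by
    [(1 - |a|^2)^2], so [nu] does not vanish. *)
Lemma geodesic_parametrization (G : C -> Prop) (a : C) :
  hyperbolic_geodesic G -> G a ->
  exists eta, Cmod eta = 1 /\ forall z, G z ->
    exists t, Rabs t < 1 /\ z = mobius a (t * eta)%C.
Proof.
intros hG hGa; destruct (geodesic_equation G hG) as (al & be & hab & heq).
destruct (heq a hGa) as [ha hea].
(* the conjugate of the coefficient of [w] after the substitution *)
set (nu := (RtoC (2 * al) * a - be - Cconj be * a * a)%C).
assert (hnu : Cmod nu ^ 2 = (Cmod be ^ 2 - al ^ 2) * (1 - Cmod a ^ 2) ^ 2 +
  (al * (1 + Cmod a ^ 2) - 2 * Re (Cconj be * a)%C) ^ 2).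
{ rewrite !Cmod2_alt; unfold nu; destruct a, be; simpl; ring. }
assert (hnu0 : 0 < Cmod nu).
{ assert (h : 0 < Cmod nu ^ 2).
  { rewrite hnu, hea.
    assert (0 < (Cmod be ^ 2 - al ^ 2) * (1 - Cmod a ^ 2) ^ 2).
    { apply Rmult_lt_0_compat; [lra | apply pow_lt].
      generalize (Cmod_lt1_sqr a ha); lra. }
    lra. }
  assert (h0 := Cmod_ge_0 nu); nra. }
assert (hnuC : RtoC (Cmod nu) <> RtoC 0) by (intros h; apply RtoC_inj in h; lra).
assert (he : Cmod (Ci * nu / Cmod nu)%C = 1).
{ rewrite Cmod_div, Cmod_mult, Cmod_Ci, Cmod_R, Rabs_pos_eq by (auto; lra); field; lra. }
(* the line [Re (conj nu w) = 0] has direction [i nu] *)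
exists (Ci * nu / Cmod nu)%C; split; auto.
intros z hz; destruct (heq z hz) as [hzd hez].
set (w := mobius (- a) z).
assert (hw : disk w) by (apply mobius_disk; auto; apply disk_opp; auto).
assert (hzw : z = mobius a w) by (symmetry; apply mobius_cancel'; auto).
assert (hperp : Re (Cconj nu * w)%C = 0).
{ assert (hn := mobius_den_neq0 a w ha (Rlt_le _ _ hw)).
  assert (hzd' : (z * (1 + Cconj a * w) = w + a)%C)
    by (rewrite hzw; unfold mobius; field; auto).
  assert (h1 : al * (Cmod (1 + Cconj a * w)%C ^ 2 + Cmod (w + a)%C ^ 2) =
    2 * Re (Cconj be * (w + a) * Cconj (1 + Cconj a * w))%C).
  { rewrite <- hzd', Cmod_mult, Rpow_mult_distr.
    replace (Cconj be * (z * (1 + Cconj a * w)) * Cconj (1 + Cconj a * w))%C with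
      (Cconj be * z * ((1 + Cconj a * w) * Cconj (1 + Cconj a * w)))%C by ring.
    rewrite <- Cmod2_conj.
    replace (Re (Cconj be * z * RtoC (Cmod (1 + Cconj a * w) ^ 2)))%C with
      (Re (Cconj be * z)%C * Cmod (1 + Cconj a * w)%C ^ 2)
      by (generalize (Cconj be * z)%C (Cmod (1 + Cconj a * w)%C ^ 2);
          intros [x y] q; simpl; ring).
    generalize (Cmod (1 + Cconj a * w)%C ^ 2); intros q.
    replace (al * (q + Cmod z ^ 2 * q)) with (al * (1 + Cmod z ^ 2) * q) by ring.
    rewrite hez; ring. }
  rewrite !Cmod2_alt in h1; rewrite Cmod2_alt in hea; unfold nu.
  clearbody w; clear - h1 hea.
  assert (h2 := f_equal (fun x => x * (1 + Re w ^ 2 + Im w ^ 2)) hea); cbv beta in h2.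
  destruct a, be, w; simpl in *; lra. }
exists (Re (Cconj (Ci * nu / Cmod nu) * w)%C).
assert (hwt : w = (Re (Cconj (Ci * nu / Cmod nu) * w)%C * (Ci * nu / Cmod nu))%C).
{ set (eta := (Ci * nu / Cmod nu)%C) in *.
  assert (him : Im (Cconj eta * w)%C = 0).
  { replace (Cconj eta * w)%C with (- Ci * (Cconj nu * w) / Cmod nu)%C.
    - revert hperp; generalize (Cconj nu * w)%C; intros [x y] hx; simpl in hx; subst x.
      unfold Cdiv; rewrite <- RtoC_inv by lra; simpl; ring.
    - unfold eta; rewrite Cdiv_conj, Cmult_conj by auto.
      replace (Cconj Ci) with (- Ci)%C by (apply injective_projections; simpl; ring).
      rewrite Cconj_RtoC; field; auto. }
  assert (hre : (RtoC (Re (Cconj eta * w)) = Cconj eta * w)%C).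
  { revert him; generalize (Cconj eta * w)%C; intros [x y] hy; simpl in hy; subst y.
    reflexivity. }
  rewrite hre; replace (Cconj eta * w * eta)%C with (eta * Cconj eta * w)%C by ring.
  rewrite unimodular_mul_conj by auto; ring. }
split.
- assert (h := hw); unfold disk in h; rewrite hwt, Cmod_mult, Cmod_R, he in h; lra.
- rewrite <- hwt; auto.
Qed.

Lemma rho_sym (z w : C) : disk z -> disk w -> rho z w = rho w z.
Proof.
intros hz hw; unfold rho.
assert (h1 := one_minus_conj_mul_neq0 z w (Rlt_le _ _ hz) hw).
assert (h2 := one_minus_conj_mul_neq0 w z (Rlt_le _ _ hw) hz).
rewrite !Cmod_div by auto; rewrite Cmod_sub_sym; f_equal.
rewrite <- (Cmod_conj (1 - Cconj z * w)%C), Cminus_conj, Cmult_conj, Cconj_conj.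
rewrite (Cmult_comm z), Cconj_RtoC; reflexivity.
Qed.

Lemma rho_mobius (a v w : C) : disk a -> disk v -> disk w ->
  rho (mobius a w) (mobius a v) = rho w v.
Proof.
intros ha hv hw; unfold rho.
assert (hv' := mobius_disk a v ha hv); assert (hw' := mobius_disk a w ha hw).
assert (h1 := one_minus_conj_mul_neq0 w v (Rlt_le _ _ hw) hv).
assert (h2 := one_minus_conj_mul_neq0 _ _ (Rlt_le _ _ hw') hv').
assert (h := mobius_isometry a v w ha hv hw).
rewrite !Cmod_div by auto; apply Cmod_gt_0 in h1, h2.
apply Rmult_eq_reg_r with (Cmod (1 - Cconj (mobius a v) * mobius a w) *
  Cmod (1 - Cconj v * w)); [| apply Rgt_not_eq, Rmult_lt_0_compat; auto].
field_simplify; [lra | lra | lra].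
Qed.

Lemma rho_mobius_center (a w : C) : disk a -> disk w -> rho (mobius a w) a = Cmod w.
Proof.
intros ha hw; rewrite <- (mobius_0 a) at 2.
rewrite rho_mobius; auto; [| unfold disk; rewrite Cmod_0; lra].
unfold rho; f_equal.
rewrite Cconj_RtoC; field.
Qed.

Lemma rho_real_multiples (eta : C) (s t : R) : Cmod eta = 1 -> Rabs s < 1 -> Rabs t < 1 ->
  rho (s * eta)%C (t * eta)%C = Rabs (s - t) / (1 - s * t).
Proof.
intros he hs ht; unfold rho.
assert (h : 0 < 1 - s * t).
{ apply Rabs_def2 in hs; apply Rabs_def2 in ht; nra. }
replace (s * eta - t * eta)%C with (RtoC (s - t) * eta)%C by (rewrite RtoC_minus; ring).
replace (1 - Cconj (t * eta) * (s * eta))%C with (RtoC (1 - s * t)).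
- rewrite Cmod_div, Cmod_mult, he, !Cmod_R by (intros e; apply RtoC_inj in e; lra).
  rewrite (Rabs_pos_eq (1 - s * t)) by lra; field; lra.
- rewrite Cmult_conj, Cconj_RtoC.
  replace (t * Cconj eta * (s * eta))%C with (s * t * (eta * Cconj eta))%C by ring.
  rewrite unimodular_mul_conj, RtoC_minus, RtoC_mult by auto; ring.
Qed.

(** For [s] and [t] on the same side of [0] the pseudo-hyperbolic distance is that of
    [|s|] and [|t|], so the logarithms subtract instead of adding. *)
Lemma additive_distance_not_same_side (s t r : R) :
  Rabs s < 1 -> Rabs t < 1 -> 0 < s * t -> r = Rabs (s - t) / (1 - s * t) ->
  ln ((1 + Rabs s) / (1 - Rabs s)) + ln ((1 + Rabs t) / (1 - Rabs t)) <>
  ln ((1 + r) / (1 - r)).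
Proof.
intros hs ht hst hr.
assert (hx : Rabs s * Rabs t = s * t) by (rewrite <- Rabs_mult; apply Rabs_pos_eq; lra).
assert (hd : Rabs (s - t) = Rabs (Rabs s - Rabs t)).
{ destruct (Rlt_dec s 0) as [h1 | h1].
  - assert (t < 0) by nra; rewrite (Rabs_left s), (Rabs_left t) by auto.
    rewrite Rabs_minus_sym; f_equal; ring.
  - assert (0 < t) by nra; rewrite (Rabs_pos_eq s), (Rabs_pos_eq t) by lra; auto. }
rewrite hd, <- hx in hr.
assert (hs0 : 0 < Rabs s) by (apply Rabs_pos_lt; intros ->; lra).
assert (ht0 : 0 < Rabs t) by (apply Rabs_pos_lt; intros ->; lra).
set (x := Rabs s) in *; set (y := Rabs t) in *; clearbody x y; clear s t hd hx hst.
assert (hxy : 0 < 1 - x * y) by nra.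
assert (hr0 : 0 <= r) by (rewrite hr; apply Rdiv_le_0_compat; [apply Rabs_pos | auto]).
assert (hr2 : r * (1 - x * y) = Rabs (x - y)) by (rewrite hr; field; lra).
assert (hr1 : r < 1).
{ rewrite hr; apply Rlt_div_l; auto; apply Rabs_def1; nra. }
rewrite <- ln_mult by (apply Rdiv_lt_0_compat; lra).
intros h; apply ln_inv in h;
  [| apply Rmult_lt_0_compat; apply Rdiv_lt_0_compat; lra | apply Rdiv_lt_0_compat; lra].
assert (h2 : (1 + x) * (1 + y) * (1 - r) = (1 + r) * ((1 - x) * (1 - y))).
{ apply (f_equal (fun q => q * ((1 - x) * (1 - y) * (1 - r)))) in h.
  field_simplify in h; lra. }
assert (h3 : r * (1 + x * y) = x + y) by lra.
unfold Rabs in hr2; destruct (Rcase_abs (x - y)).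
- assert (h4 : (y - x) * (1 + x * y) = (x + y) * (1 - x * y)).
  { rewrite <- h3; replace (y - x) with (r * (1 - x * y)) by lra; ring. }
  assert (0 < x * (1 - y * y)) by (apply Rmult_lt_0_compat; nra); nra.
- assert (h4 : (x - y) * (1 + x * y) = (x + y) * (1 - x * y)).
  { rewrite <- h3; replace (x - y) with (r * (1 - x * y)) by lra; ring. }
  assert (0 < y * (1 - x * x)) by (apply Rmult_lt_0_compat; nra); nra.
Qed.

(** Additivity of the distance places the endpoints on opposite sides of [z] on the
    geodesic, which is parametrized from [z]. *)
Lemma segment_opposite_sides (z1 z2 z : C) : hyperbolic_segment z1 z2 z ->
  z = z1 \/ z = z2 \/ exists eta t1 t2, disk z /\ Cmod eta = 1 /\
    -1 < t1 /\ t1 < 0 /\ 0 < t2 /\ t2 < 1 /\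
    ((z1 = mobius z (t1 * eta)%C /\ z2 = mobius z (t2 * eta)%C) \/
     (z2 = mobius z (t1 * eta)%C /\ z1 = mobius z (t2 * eta)%C)).
Proof.
intros (G & hG & h1 & h2 & hz & hadd).
destruct (geodesic_parametrization G z hG hz) as (eta & he & hpar).
destruct (geodesic_equation G hG) as (al & be & _ & heq).
assert (hzd := proj1 (heq z hz)).
destruct (hpar z1 h1) as (s & hs & e1), (hpar z2 h2) as (t & ht & e2).
assert (hsd := real_mul_disk s eta he hs); assert (htd := real_mul_disk t eta he ht).
assert (hm1 := mobius_disk z _ hzd hsd); assert (hm2 := mobius_disk z _ hzd htd).
destruct (Req_dec s 0) as [-> | hs0].
{ left; rewrite e1, Cmult_0_l, mobius_0; auto. }
destruct (Req_dec t 0) as [-> | ht0].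
{ right; left; rewrite e2, Cmult_0_l, mobius_0; auto. }
right; right.
assert (hopp : s * t < 0).
{ apply Rnot_le_lt; intros hle.
  assert (hst : 0 < s * t) by (destruct hle as [h | h]; auto; nra).
  apply (additive_distance_not_same_side s t (Rabs (s - t) / (1 - s * t)) hs ht hst);
    auto.
  unfold poincare_dist in hadd; rewrite e1, e2 in hadd.
  rewrite (rho_sym z) in hadd by auto.
  rewrite !rho_mobius_center, rho_mobius, rho_real_multiples, !Cmod_mult, !Cmod_R, he,
    !Rmult_1_r in hadd by auto.
  exact hadd. }
apply Rabs_def2 in hs; apply Rabs_def2 in ht.
destruct (Rlt_dec s 0) as [h | h].
- exists eta, s, t; repeat split; auto; try lra; nra.
- exists eta, t, s; repeat split; auto; try lra; nra.
Qed.

(** * Topology of the sublevel sets *)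

Lemma locally_Cmod (z : C) (P : C -> Prop) :
  @locally C_UniformSpace z P <-> exists d, 0 < d /\ forall w, Cmod (w - z) < d -> P w.
Proof. rewrite <- locally_metric; exact (locally_C z P). Qed.

Lemma open_Cmod (A : C -> Prop) : @open C_UniformSpace A <->
  forall z, A z -> exists d, 0 < d /\ forall w, Cmod (w - z) < d -> A w.
Proof.
split; intros h z hz; specialize (h z hz); apply locally_Cmod; auto.
Qed.

Lemma boundary_not_interior (A : C -> Prop) (p : C) : boundary A p ->
  (~ exists d, 0 < d /\ forall w, Cmod (w - p) < d -> A w) /\
  (~ exists d, 0 < d /\ forall w, Cmod (w - p) < d -> ~ A w).
Proof.
intros hb; split; intros h.
- apply (locally_Cmod p A) in h; destruct h as [e he].
  destruct (hb e) as [_ (w & hw & hA)]; exact (hA (he w hw)).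
- apply (locally_Cmod p (fun w => ~ A w)) in h; destruct h as [e he].
  destruct (hb e) as [(w & hw & hA) _]; exact (he w hw hA).
Qed.

(** Along the segment from [0] to [z], membership in an open piece [U] of a separation
    propagates by [box_induction], the second coordinate being idle. *)
Lemma connected_of_star_shaped (A : C -> Prop) : A 0 ->
  (forall z t, A z -> 0 <= t <= 1 -> A (t * z)%C) -> connected A.
Proof.
intros h0 hstar.
assert (half : forall U V : C -> Prop, open U -> open V ->
  (forall z, A z -> U z \/ V z) -> (forall z, ~ (A z /\ U z /\ V z)) ->
  U 0 -> forall z, A z -> U z).
{ intros U V hU hV hcov hdis hU0 z hz.
  assert (hU' := proj1 (open_Cmod U) hU); assert (hV' := proj1 (open_Cmod V) hV).
  assert (h : U (RtoC 0 * z)%C -> U (RtoC 1 * z)%C).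
  { apply (box_induction (fun a b _ _ => U (a * z)%C -> U (b * z)%C) 0 1 0 0); try lra.
    - intros a b c d _ _ _ _ _ _ i1 i2 _ _ h; auto.
    - intros t y ht _.
      assert (near : forall W : C -> Prop,
        (exists d, 0 < d /\ forall w, Cmod (w - t * z) < d -> W w) ->
        exists d, 0 < d /\ forall s, Rabs (s - t) < d -> W (s * z)%C).
      { intros W (d & hd & hw).
        assert (hz0 := Cmod_ge_0 z).
        exists (d / (Cmod z + 1)); split; [apply Rdiv_lt_0_compat; lra |].
        intros s hs; apply hw.
        replace (s * z - t * z)%C with (RtoC (s - t) * z)%C by (rewrite RtoC_minus; ring).
        rewrite Cmod_mult, Cmod_R; apply Rlt_div_r in hs; [| lra].
        generalize (Rabs_pos (s - t)); nra. }
      destruct (hcov (t * z)%C (hstar z t hz ht)) as [hin | hin].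
      + destruct (near U (hU' _ hin)) as (d & hd & hw).
        exists d; split; auto; intros a b _ _ _ h1 h2 _ _ _ _ _ h3 _ _.
        apply hw, Rabs_def1; lra.
      + destruct (near V (hV' _ hin)) as (d & hd & hw).
        exists d; split; auto; intros a b _ _ h0a h1 h2 h2b _ _ _ _ h3 _ hUa.
        exfalso; apply (hdis (a * z)%C); split; [apply hstar; auto; lra | split; auto].
        apply hw, Rabs_def1; lra. }
  rewrite Cmult_0_l, Cmult_1_l in h; auto. }
intros U V hU hV hcov hdis [(z & hz & hUz) (w & hw & hVw)].
destruct (hcov 0 h0) as [hin | hin].
- apply (hdis w); repeat split; auto; apply (half U V); auto.
- apply (hdis z); repeat split; auto; apply (half V U); auto.
  + intros y hy; destruct (hcov y hy); auto.
  + intros y (k1 & k2 & k3); apply (hdis y); auto.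
Qed.

Lemma density_stays_below (f : C -> C) (lambda : R) (z : C) :
  holomorphic_self_map f -> disk z -> density f z < lambda ->
  exists d, 0 < d /\ forall w, Cmod (w - z) < d -> density f w < lambda.
Proof.
intros hf hz hlt; apply (locally_metric z (fun w => density f w < lambda)).
apply (continuous_density f z hf hz (fun x => x < lambda)), open_lt; auto.
Qed.

Lemma density_stays_above (f : C -> C) (lambda : R) (z : C) :
  holomorphic_self_map f -> disk z -> lambda < density f z ->
  exists d, 0 < d /\ forall w, Cmod (w - z) < d -> lambda < density f w.
Proof.
intros hf hz hlt; apply (locally_metric z (fun w => lambda < density f w)).
apply (continuous_density f z hf hz (fun x => lambda < x)), open_gt; auto.
Qed.

Lemma disk_open (z : C) : disk z -> exists d, 0 < d /\ forall w, Cmod (w - z) < d -> disk w.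
Proof.
unfold disk; intros hz; exists (1 - Cmod z); split; [lra |].
intros w hw; generalize (Cmod_triangle_sub w z); lra.
Qed.

Lemma open_Omega (lambda : R) (f : C -> C) : holomorphic_self_map f ->
  open (Omega lambda f).
Proof.
intros hf; apply open_Cmod; intros z [hz hlt].
destruct (disk_open z hz) as (d1 & hd1 & hw1).
destruct (density_stays_below f lambda z hf hz hlt) as (d2 & hd2 & hw2).
exists (Rmin d1 d2); split; [apply Rmin_case; auto |].
assert (h1 := Rmin_l d1 d2); assert (h2 := Rmin_r d1 d2).
intros w hw; split; [apply hw1 | apply hw2]; lra.
Qed.

Lemma density_boundary_Omega (lambda : R) (f : C -> C) (p : C) :
  holomorphic_self_map f -> disk p -> boundary (Omega lambda f) p -> density f p = lambda.
Proof.
intros hf hp hb; destruct (boundary_not_interior _ p hb) as [h1 h2].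
apply Rle_antisym; apply Rnot_lt_le; intros hlt.
- apply h2; destruct (density_stays_above f lambda p hf hp hlt) as (d & hd & hw).
  exists d; split; auto; intros w hwp [_ hO]; specialize (hw w hwp).
  unfold density in hw; lra.
- apply h1, (proj1 (open_Cmod _) (open_Omega lambda f hf)); split; auto.
Qed.

Theorem theorem3p1 (lambda : R) (f : C -> C)
  (hlambda : 1 <= lambda)
  (hf : holomorphic_self_map f)
  (hf1 : lambda = 1 -> f (RtoC 0) <> RtoC 0 /\ ~ disk_automorphism f) :
  strictly_h_convex (Omega lambda f) /\
  is_domain (Omega lambda f) /\
  Omega lambda f (RtoC 0).
Proof.
assert (haut : lambda = 1 -> ~ disk_automorphism f) by (intros e; apply hf1; auto).
assert (hbetween := fun a eta t1 t t2 => density_lt_between lambda f a eta t1 t t2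
  hlambda hf haut).
assert (hO : forall z, Omega lambda f z <-> disk z /\ density f z < lambda)
  by (intros z; reflexivity).
assert (hd0 : disk 0) by (unfold disk; rewrite Cmod_0; lra).
assert (h0 : Omega lambda f (RtoC 0)).
{ apply hO; split; auto; unfold density; rewrite Cmod_0.
  assert (hle := pow2_ge_0 (Cmod (f 0))).
  destruct (Req_dec lambda 1) as [e | n]; [| lra].
  assert (hn := proj1 (Cmod_gt_0 _) (proj1 (hf1 e))).
  assert (0 < Cmod (f 0) ^ 2) by (apply pow_lt; auto); lra. }
split; [split; [split |] | split; [split; [| split] |]]; auto.
- intros z [hz _]; auto.
- intros z1 z2 h1 h2 z hz.
  destruct (segment_opposite_sides z1 z2 z hz) as
    [-> | [-> | (eta & t1 & t2 & hzd & he & k1 & k2 & k3 & k4 & hends)]]; auto.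
  destruct h1 as [_ h1], h2 as [_ h2]; apply hO; split; auto.
  rewrite <- (mobius_0 z), <- (Cmult_0_l eta).
  destruct hends as [[-> ->] | [-> ->]];
    apply (hbetween z eta t1 0 t2); auto; left; auto.
- intros G hG p q r hp hq hr bp bq br.
  destruct (geodesic_equation G hG) as (al & be & _ & heq).
  assert (dens : forall z, G z -> boundary (Omega lambda f) z -> density f z = lambda)
    by (intros z hz; apply density_boundary_Omega; auto; apply heq; auto).
  assert (hpd := proj1 (heq p hp)).
  destruct (geodesic_parametrization G p hG hp) as (eta & he & hpar).
  destruct (hpar q hq) as (s & hs & eq), (hpar r hr) as (t & ht & er).
  assert (ep : p = mobius p (RtoC 0 * eta)%C) by (rewrite Cmult_0_l, mobius_0; auto).
  apply dens in bp, bq, br; auto.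
  rewrite eq in bq; rewrite er in br; rewrite ep in bp.
  apply Rabs_def2 in hs; apply Rabs_def2 in ht.
  assert (no : forall t1 t2 t3 : R, -1 < t1 -> t3 < 1 ->
    density f (mobius p (t1 * eta)%C) = lambda ->
    density f (mobius p (t2 * eta)%C) = lambda ->
    density f (mobius p (t3 * eta)%C) = lambda -> t1 < t2 -> t2 < t3 -> False).
  { intros t1 t2 t3 k1 k2 e1 e2 e3 k3 k4.
    assert (h := hbetween p eta t1 t2 t3 hpd he k1 k3 k4 k2 ltac:(lra) ltac:(lra)); lra. }
  destruct (Req_dec s 0) as [-> | hs0]; [left; congruence |].
  destruct (Req_dec t 0) as [-> | ht0]; [right; left; congruence |].
  destruct (Req_dec s t) as [-> | hst]; [right; right; congruence |].
  exfalso; destruct (Rtotal_order s 0) as [a | [a | a]],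
    (Rtotal_order t 0) as [b | [b | b]], (Rtotal_order s t) as [c | [c | c]];
    try lra.
  + apply (no s t 0); auto; lra.
  + apply (no t s 0); auto; lra.
  + apply (no s 0 t); auto; lra.
  + apply (no t 0 s); auto; lra.
  + apply (no 0 s t); auto; lra.
  + apply (no 0 t s); auto; lra.
- exists (RtoC 0); auto.
- apply open_Omega; auto.
- apply connected_of_star_shaped; auto.
  intros z t hz ht; destruct hz as [hzd hz].
  destruct (Req_dec (Cmod z) 0) as [e | n].
  { apply Cmod_eq_0 in e; subst z; rewrite Cmult_0_r; auto. }
  destruct (Req_dec t 0) as [-> | t0]; [rewrite Cmult_0_l; auto |].
  destruct (Req_dec t 1) as [-> | t1]; [rewrite Cmult_1_l; split; auto |].
  assert (hz0 := Cmod_ge_0 z); unfold disk in hzd.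
  assert (hzC : RtoC (Cmod z) <> RtoC 0) by (intros e; apply RtoC_inj in e; lra).
  assert (hmob : forall w, w = mobius 0 w).
  { intros w; unfold mobius; rewrite Cconj_RtoC; field. }
  assert (hray : forall s : R, (s * z)%C = mobius 0 ((s * Cmod z)%R * (z / Cmod z))%C).
  { intros s; rewrite <- hmob, RtoC_mult; field; auto. }
  apply hO; split; [unfold disk; rewrite Cmod_mult, Cmod_R, Rabs_pos_eq; nra |].
  rewrite hray; apply (hbetween 0 (z / Cmod z)%C (0 * Cmod z) (t * Cmod z) (1 * Cmod z));
    auto; try nra.
  + rewrite Cmod_div, Cmod_R, Rabs_pos_eq by (auto; lra); field; auto.
  + rewrite <- hray, Cmult_0_l; left; apply h0.
  + rewrite <- hray, Cmult_1_l; left; auto.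
Qed.
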